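(* Let $\alpha$ be a real number with $0<\alpha<1$ and let $a,b,c$ be complex numbers satisfying $ab\neq0$ and $c\neq0,-1,-2,\dots$. The shifted hypergeometric function $f(z)=z\,{}_2F_1(a,b;c;z)$ is strongly starlike of order $\alpha$ if the following three conditions are satisfied: (i) $p=a+b+1-c$ is a real number; (ii) $|\arg(ab-p)|<\pi\alpha/2$; (iii) for all $s\in(0,+\infty)$ and both signs $\varepsilon=\pm1$, $$G_\varepsilon(s^\alpha)\le\alpha(s+s^{-1})s^\alpha\operatorname{Re}\left[(ab-p)e^{\varepsilon\pi i(1-\alpha)/2}\right],$$ where $G_\varepsilon(x)=Sx^3+T_\varepsilon x^2+U_\varepsilon x+V$ with $$S=2p\cos\frac{\pi\alpha}2,$$ $$T_\varepsilon=|a|^2+|b|^2-|c-1|^2-2p-4p\cos^2\frac{\pi\alpha}2+4\operatorname{Re}[ae^{-\varepsilon i\pi\alpha/2}]\operatorname{Re}[be^{-\varepsilon i\pi\alpha/2}],$$ $$U_\varepsilon=-2(|a|^2+|b|^2-|c-1|^2-3p)\cos\frac{\pi\alpha}2+2\operatorname{Re}[ae^{-\varepsilon i\pi\alpha/2}](|b|^2-2\operatorname{Re}b)+2\operatorname{Re}[be^{-\varepsilon i\pi\alpha/2}](|a|^2-2\operatorname{Re}a),$$ $$V=|a|^2+|b|^2-|c-1|^2-2p+(|a|^2-2\operatorname{Re}a)(|b|^2-2\operatorname{Re}b).$$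
   Context: $\mathbb{D}=\{z\in\mathbb{C}:|z|<1\}$. For $c\neq0,-1,-2,\dots$, the hypergeometric function is ${}_2F_1(a,b;c;z)=\sum_{n=0}^\infty\frac{(a)_n(b)_n}{(c)_n\,n!}z^n$ for $|z|<1$, where $(a)_0=1$ and $(a)_n=a(a+1)\cdots(a+n-1)$ for $n\ge1$. For $0<\alpha<1$, an analytic function $f$ on $\mathbb{D}$ with $f(0)=f'(0)-1=0$ is called strongly starlike of order $\alpha$ if $\left|\arg\frac{zf'(z)}{f(z)}\right|<\frac{\pi\alpha}2$ for all $z\in\mathbb{D}$ (where $zf'(z)/f(z)$ takes the value $1$ at $z=0$). Here $\arg$ is the principal argument of a nonzero complex number; a condition $|\arg w|<\cdots$ includes $w\neq0$. *)

(* Defs.v *)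
From Stdlib Require Import Reals Factorial Lra Lia.
From Coquelicot Require Import Coquelicot.

Open Scope C_scope.

(** Principal argument, with values in (-PI, PI], see [Carg_spec]; [Carg 0] is a
    junk value. *)
Definition Carg (w : C) : R :=
  if Rle_dec 0 (Im w) then acos (Re w / Cmod w) else (- acos (Re w / Cmod w))%R.

Definition abs_arg_lt (w : C) (t : R) : Prop :=
  w <> 0 /\ (Rabs (Carg w) < t)%R.

(** [expi t] is exp(i t). *)
Definition expi (t : R) : C := (cos t, sin t).

Lemma Carg_spec (w : C) :
  w <> 0 -> w = Cmod w * expi (Carg w) /\ (- PI < Carg w <= PI)%R.
Proof.
  intros Hw.
  assert (Hm : (0 < Cmod w)%R) by now apply Cmod_gt_0.
  assert (Hsq : (Cmod w ^ 2 = Re w ^ 2 + Im w ^ 2)%R) by apply Cmod2_alt.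
  assert (Hq : (-1 <= Re w / Cmod w <= 1)%R).
  { pose proof (re_le_Cmod w) as H. apply Rabs_le_between in H.
    split.
    - apply Rmult_le_reg_r with (Cmod w); [lra|]. unfold Rdiv.
      rewrite Rmult_assoc, Rinv_l; lra.
    - apply Rmult_le_reg_r with (Cmod w); [lra|]. unfold Rdiv.
      rewrite Rmult_assoc, Rinv_l; lra. }
  assert (Hs : (Cmod w * sin (acos (Re w / Cmod w)) = Rabs (Im w))%R).
  { rewrite sin_acos by exact Hq.
    assert (E : (1 - (Re w / Cmod w)² = (Im w / Cmod w)²)%R).
    { unfold Rsqr. replace 1%R with (Cmod w ^ 2 / Cmod w ^ 2)%R by (field; lra).
      rewrite Hsq at 1. field. lra. }
    rewrite E, sqrt_Rsqr_abs. unfold Rdiv. rewrite Rabs_mult, (Rabs_pos_eq (/ Cmod w)).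
    - field; lra.
    - apply Rlt_le, Rinv_0_lt_compat, Hm. }
  pose proof (acos_bound (Re w / Cmod w)) as Hb.
  pose proof PI_RGT_0 as HPI.
  unfold Carg, expi. destruct (Rle_dec 0 (Im w)) as [Hi|Hi].
  - rewrite (Rabs_pos_eq _ Hi) in Hs. split; [|lra].
    rewrite cos_acos by exact Hq. apply injective_projections; simpl.
    + change (fst w) with (Re w). field. lra.
    + change (snd w) with (Im w). rewrite <- Hs. ring.
  - rewrite Rabs_left in Hs by lra. split.
    + rewrite cos_neg, sin_neg, cos_acos by exact Hq.
      apply injective_projections; simpl.
      * change (fst w) with (Re w). field. lra.
      * change (snd w) with (Im w). nra.
    + split; [|lra].
      assert (acos (Re w / Cmod w) <> PI) as Hne; [|lra].
      intros E. rewrite E, sin_PI in Hs. lra.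
Qed.

Fixpoint pochhammer (a : C) (n : nat) : C :=
  match n with
  | O => 1
  | S m => pochhammer a m * (a + INR m)
  end.

Definition hyp2F1_term (a b c z : C) (n : nat) : C :=
  pochhammer a n * pochhammer b n / (pochhammer c n * INR (fact n)) * z ^ n.

(** [Series] is real-valued, so the complex sum is taken componentwise; see
    [hyp2F1_is_series]. *)
Definition hyp2F1 (a b c z : C) : C :=
  (Series (fun n => Re (hyp2F1_term a b c z n)),
   Series (fun n => Im (hyp2F1_term a b c z n))).

Lemma hyp2F1_is_series (a b c z w : C) :
  is_series (hyp2F1_term a b c z) w -> hyp2F1 a b c z = w.
Proof.
  intros H. unfold hyp2F1, Re, Im.
  assert (Hs : forall (u : nat -> C) n,
             sum_n u n = (sum_n (fun k => fst (u k)) n, sum_n (fun k => snd (u k)) n)).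
  { intros u n. induction n as [|n IH].
    - rewrite !sum_O. apply surjective_pairing.
    - rewrite !sum_Sn, IH. reflexivity. }
  apply injective_projections; simpl; apply is_series_unique.
  - intros P [e He].
    assert (Hl : locally w (fun x : C => P (fst x))).
    { exists e. intros y [Hy _]. apply He, Hy. }
    specialize (H _ Hl). unfold filtermap in *.
    revert H. apply filter_imp. intros n. now rewrite Hs.
  - intros P [e He].
    assert (Hl : locally w (fun x : C => P (snd x))).
    { exists e. intros y [_ Hy]. apply He, Hy. }
    specialize (H _ Hl). unfold filtermap in *.
    revert H. apply filter_imp. intros n. now rewrite Hs.
Qed.

Definition holomorphic_on_disk (f : C -> C) : Prop :=
  forall z : C, (Cmod z < 1)%R -> ex_derive f z.

Definition starlike_quotient (f : C -> C) (z : C) : C :=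
  if Ceq_dec z 0 then 1 else z * C_derive f z / f z.

Definition strongly_starlike (alpha : R) (f : C -> C) : Prop :=
  holomorphic_on_disk f /\
  f 0 = 0 /\
  C_derive f 0 = 1 /\
  forall z : C, (Cmod z < 1)%R ->
    (z <> 0 -> f z <> 0) /\
    abs_arg_lt (starlike_quotient f z) (PI * alpha / 2).

Definition rot_re (alpha eps : R) (w : C) : R :=
  Re (w * expi (- (eps * (PI * alpha / 2)))).

Definition G_S (alpha p : R) : R := (2 * p * cos (PI * alpha / 2))%R.

Definition G_T (alpha : R) (a b c : C) (p eps : R) : R :=
  (Cmod a ^ 2 + Cmod b ^ 2 - Cmod (c - 1)%C ^ 2 - 2 * p
   - 4 * p * cos (PI * alpha / 2) ^ 2
   + 4 * rot_re alpha eps a * rot_re alpha eps b)%R.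

Definition G_U (alpha : R) (a b c : C) (p eps : R) : R :=
  (- 2 * (Cmod a ^ 2 + Cmod b ^ 2 - Cmod (c - 1)%C ^ 2 - 3 * p)
       * cos (PI * alpha / 2)
   + 2 * rot_re alpha eps a * (Cmod b ^ 2 - 2 * Re b)
   + 2 * rot_re alpha eps b * (Cmod a ^ 2 - 2 * Re a))%R.

Definition G_V (a b c : C) (p : R) : R :=
  (Cmod a ^ 2 + Cmod b ^ 2 - Cmod (c - 1)%C ^ 2 - 2 * p
   + (Cmod a ^ 2 - 2 * Re a) * (Cmod b ^ 2 - 2 * Re b))%R.

Definition G (alpha : R) (a b c : C) (p eps x : R) : R :=
  (G_S alpha p * x ^ 3 + G_T alpha a b c p eps * x ^ 2
   + G_U alpha a b c p eps * x + G_V a b c p)%R.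

(* Main.v *)
Require Import Defs.
From Stdlib Require Import Reals Factorial Lra Lia.
From Stdlib Require Import Classical ClassicalEpsilon FunctionalExtensionality.
From Coquelicot Require Import Coquelicot.

(** Let f(z) = z F(z) with F the hypergeometric function, and let q = z f'/f, so
    that q(0) = 1. The claim is that q stays in the sector |arg w| < beta, where
    beta = pi alpha / 2.

    The hypergeometric equation, in its Euler form
    theta (theta + c - 1) F = z (theta + a) (theta + b) F with theta = z d/dz,
    turns into the Riccati equation N = z (N + D), where
    N = theta q + (q-1)(q+c-2) and D = p q + (ab - p) ([quot_equation]). Since
    |z| < 1, this forces |N| < |N + D| unless N = D = 0.

    If the claim fails, take a point z0 of least modulus r at which F vanishes or q
    is outside the open sector ([compact_max] gives it). On |z| < r the function q
    maps into the sector, so u = q^(1/alpha) maps into the right half-plane and the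
    Schwarz lemma applies to (u-1)/(u+1) ([sector_schwarz]). Three cases remain.
    - F(z0) = 0: impossible, because Re q > 0 makes |f| increase along the radius
      ([quot_Re_pos_neq_0]).
    - q(z0) = 0: impossible, because the Schwarz lemma bounds |q| below by a
      multiple of (r-|z|)^alpha with alpha < 1 ([boundary_neq_0]).
    - q(z0) = x exp(i eps beta) with x > 0: then theta q = i eps mu q at z0 with
      mu >= alpha (s + 1/s) / 2, where s = x^(1/alpha)
      ([boundary_log_derivative]). As p is real, |N + D|^2 - |N|^2 equals
      G_eps(x) - 2 mu x Re [(ab - p) exp(i eps (pi/2 - beta))] ([G_sqmod]), and the
      inequality assumed on G_eps makes this nonpositive; the case N = D = 0 would
      give ab - p = - p q, which the bound on arg (ab - p) excludes
      ([side_contradiction]).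

    The Schwarz lemma ([schwarz_lemma]) is obtained without integration. For a
    holomorphic omega, ln |omega/z|^2 has a gradient given by a complex
    differentiable function, so its second derivatives in the directions 1 and i
    cancel, and a small strictly subharmonic perturbation has no interior maximum
    ([no_local_max]). Only derivatives along real lines enter ([cder]); genuine
    complex differentiability is established for power series ([cdiff_powser]). *)

Local Open Scope C_scope.

(** * Complex power series on the unit disk *)

Definition cseries (u : nat -> C) : C :=
  (Series (fun n => Re (u n)), Series (fun n => Im (u n))).

Lemma is_series_cseries (u : nat -> C) (w : C) : is_series u w -> cseries u = w.
Proof.
  intros H. unfold cseries.
  assert (Hs : forall n, sum_n u n
    = (sum_n (fun k => Re (u k)) n, sum_n (fun k => Im (u k)) n)).
  { intros n. induction n as [|n IH].
    - rewrite !sum_O. apply surjective_pairing.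
    - rewrite !sum_Sn, IH. reflexivity. }
  apply injective_projections; simpl; apply is_series_unique.
  - intros P [e He].
    assert (Hl : locally w (fun x : C => P (fst x))).
    { exists e. intros y [Hy _]. apply He, Hy. }
    specialize (H _ Hl). unfold filtermap in *.
    revert H. apply filter_imp. intros n. now rewrite Hs.
  - intros P [e He].
    assert (Hl : locally w (fun x : C => P (snd x))).
    { exists e. intros y [_ Hy]. apply He, Hy. }
    specialize (H _ Hl). unfold filtermap in *.
    revert H. apply filter_imp. intros n. now rewrite Hs.
Qed.

Lemma cseries_dominated (u : nat -> C) (v : nat -> R) :
  (forall n, (Cmod (u n) <= v n)%R) -> ex_series v ->
  is_series u (cseries u) /\ (Cmod (cseries u) <= Series v)%R.
Proof.
  intros Hb Hv.
  assert (Hu : ex_series (V := C_NormedModule) u).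
  { apply (@ex_series_le C_AbsRing C_CompleteNormedModule u v); [|exact Hv].
    intros n. change (Cmod (u n) <= v n)%R. apply Hb. }
  destruct Hu as [w Hw].
  assert (E : cseries u = w) by now apply is_series_cseries.
  rewrite E. split; [exact Hw|].
  apply (is_lim_seq_le (fun n => Cmod (sum_n u n)) (fun n => sum_n v n)
           (Cmod w) (Series v)).
  - intros n.
    eapply Rle_trans; [apply (norm_sum_n_m (V := C_NormedModule) u 0 n)|].
    apply sum_n_m_le. exact Hb.
  - apply (filterlim_comp _ _ _ (sum_n u) Cmod eventually (locally w)).
    + exact Hw.
    + eapply filterlim_ext; [|apply (@filterlim_norm C_AbsRing C_NormedModule)].
      reflexivity.
  - apply (Series_correct v Hv).
Qed.

(** That is, the power series with coefficients A has radius of convergence at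
    least 1. *)
Definition tempered (A : nat -> C) : Prop :=
  forall r, (0 < r < 1)%R -> exists M, forall n, (Cmod (A n) * r ^ n <= M)%R.

(** Defined for all z by the componentwise sum, as the hypergeometric series is. *)
Definition powser (A : nat -> C) (z : C) : C := cseries (fun n => A n * z ^ n).

(** The coefficients of the derivative; the next definition gives those of z d/dz. *)
Definition dcoef (A : nat -> C) (n : nat) : C := INR (S n) * A (S n).

Definition euler_coef (A : nat -> C) (n : nat) : C := INR n * A n.

Lemma Cmod_INR (n : nat) : Cmod (INR n) = INR n.
Proof. rewrite Cmod_R. apply Rabs_pos_eq, pos_INR. Qed.

Lemma succ_mul_pow_bound (x : R) (n : nat) :
  (0 <= x < 1)%R -> (INR (S n) * x ^ n * (1 - x) <= 1)%R.
Proof.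
  intros Hx.
  assert (H : (INR (S n) * x ^ n * (1 - x) <= 1 - x ^ S n)%R).
  { induction n as [|n IH].
    - simpl. lra.
    - rewrite S_INR. assert (0 <= x ^ n)%R by (apply pow_le; lra).
      assert (x ^ S n <= 1)%R.
      { rewrite <- (pow1 (S n)). apply pow_incr. lra. }
      assert (Hp : (0 <= x ^ S n)%R) by (apply pow_le; lra).
      pose proof (pos_INR (S n)) as Hn.
      replace ((INR (S n) + 1) * x ^ S n * (1 - x))%R
        with (x * (INR (S n) * x ^ n * (1 - x)) + x ^ S n * (1 - x))%R
        by (simpl; ring).
      apply Rle_trans with (x * (1 - x ^ S n) + x ^ S n * (1 - x))%R.
      + apply Rplus_le_compat_r, Rmult_le_compat_l; lra.
      + change (x ^ S (S n))%R with (x * x ^ S n)%R. nra. }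
  assert (0 <= x ^ S n)%R by (apply pow_le; lra). lra.
Qed.

Lemma tempered_euler_coef (A : nat -> C) : tempered A -> tempered (euler_coef A).
Proof.
  intros HA r Hr.
  assert (Hrho : (0 < (1 + r) / 2 < 1)%R) by lra.
  set (rho := ((1 + r) / 2)%R) in *.
  destruct (HA rho Hrho) as [M HM].
  assert (Hx : (0 <= r / rho < 1)%R).
  { split.
    - apply Rlt_le, Rdiv_lt_0_compat; lra.
    - apply Rmult_lt_reg_r with rho; [lra|]. unfold Rdiv.
      rewrite Rmult_assoc, Rinv_l; unfold rho; lra. }
  exists (M * / (1 - r / rho))%R. intros n. unfold euler_coef.
  rewrite Cmod_mult, Cmod_INR.
  assert (E : (r ^ n = rho ^ n * (r / rho) ^ n)%R).
  { rewrite <- Rpow_mult_distr. f_equal. field. lra. }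
  rewrite E.
  replace (INR n * Cmod (A n) * (rho ^ n * (r / rho) ^ n))%R
    with ((Cmod (A n) * rho ^ n) * (INR n * (r / rho) ^ n))%R by ring.
  apply Rmult_le_compat.
  - apply Rmult_le_pos; [apply Cmod_ge_0|apply pow_le; lra].
  - apply Rmult_le_pos; [apply pos_INR|apply pow_le; lra].
  - apply HM.
  - apply Rmult_le_reg_r with (1 - r / rho)%R; [lra|].
    rewrite Rinv_l by lra.
    eapply Rle_trans; [|apply (succ_mul_pow_bound (r / rho) n Hx)].
    apply Rmult_le_compat_r; [lra|]. apply Rmult_le_compat_r; [apply pow_le; lra|].
    rewrite S_INR. lra.
Qed.

Lemma tempered_shift (A : nat -> C) : tempered A -> tempered (fun n => A (S n)).
Proof.
  intros HA r Hr. destruct (HA r Hr) as [M HM]. exists (M / r)%R.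
  intros n. apply Rmult_le_reg_r with r; [lra|].
  replace (M / r * r)%R with M by (field; lra).
  specialize (HM (S n)). simpl in HM. lra.
Qed.

Lemma tempered_dcoef (A : nat -> C) : tempered A -> tempered (dcoef A).
Proof. intros HA. apply (tempered_shift _ (tempered_euler_coef _ HA)). Qed.

Lemma tempered_ex_series (A : nat -> C) (r : R) :
  tempered A -> (0 <= r < 1)%R -> ex_series (fun n => Cmod (A n) * r ^ n)%R.
Proof.
  intros HA Hr.
  assert (Hrho : (0 < (1 + r) / 2 < 1)%R) by lra.
  set (rho := ((1 + r) / 2)%R) in *.
  destruct (HA rho Hrho) as [M HM].
  assert (Hx : (0 <= r / rho < 1)%R).
  { split.
    - apply Rmult_le_pos; [lra|apply Rlt_le, Rinv_0_lt_compat; lra].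
    - apply Rmult_lt_reg_r with rho; [lra|]. unfold Rdiv.
      rewrite Rmult_assoc, Rinv_l; unfold rho; lra. }
  apply (@ex_series_le R_AbsRing R_CompleteNormedModule _ (fun n => M * (r / rho) ^ n)%R).
  - intros n. change (norm (Cmod (A n) * r ^ n)%R) with (Rabs (Cmod (A n) * r ^ n)%R).
    rewrite Rabs_pos_eq by (apply Rmult_le_pos; [apply Cmod_ge_0|apply pow_le; lra]).
    assert (E : (r ^ n = rho ^ n * (r / rho) ^ n)%R).
    { rewrite <- Rpow_mult_distr. f_equal. field. lra. }
    rewrite E, <- Rmult_assoc. apply Rmult_le_compat_r; [apply pow_le; lra|apply HM].
  - apply (ex_series_scal_l M (fun n => (r / rho) ^ n)%R). apply ex_series_geom.
    rewrite Rabs_pos_eq; lra.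
Qed.

Lemma is_series_powser (A : nat -> C) (z : C) :
  tempered A -> (Cmod z < 1)%R -> is_series (fun n => A n * z ^ n) (powser A z).
Proof.
  intros HA Hz. apply (cseries_dominated _ (fun n => Cmod (A n) * Cmod z ^ n)%R).
  - intros n. rewrite Cmod_mult, Cmod_pow. lra.
  - apply tempered_ex_series; auto. split; [apply Cmod_ge_0|exact Hz].
Qed.

Lemma powser_0 (A : nat -> C) : tempered A -> powser A 0 = A O.
Proof.
  intros HA. apply is_series_cseries.
  apply (is_series_decr_1 (fun n => A n * 0 ^ n)).
  match goal with |- is_series _ ?l => replace l with (RtoC 0) end.
  2: { change (RtoC 0 = A O - (A O * 1)). ring. }
  eapply is_series_ext with (fun _ : nat => RtoC 0).
  - intros n. change (RtoC 0 = A (S n) * (0 * 0 ^ n)). ring.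
  - assert (H0 : forall n, sum_n (fun _ : nat => RtoC 0) n = RtoC 0).
    { intros n. induction n; [now rewrite sum_O|]. rewrite sum_Sn, IHn.
      change (RtoC 0 + RtoC 0 = RtoC 0). ring. }
    intros P [e He]. exists O. intros n _. rewrite H0. apply He, ball_center.
Qed.

Lemma is_series_mul_id (A : nat -> C) (z w : C) :
  is_series (fun n => A (S n) * z ^ n) w -> A O = 0 ->
  is_series (fun n => A n * z ^ n) (z * w).
Proof.
  intros H H0. apply (is_series_decr_1 (fun n => A n * z ^ n)).
  match goal with |- is_series _ ?l => replace l with (scal z w) end.
  - eapply is_series_ext; [|apply (is_series_scal z _ _ H)].
    intros n. simpl. change (z * (A (S n) * z ^ n) = A (S n) * (z * z ^ n)). ring.
  - change (z * w = z * w - A O * 1). rewrite H0. ring.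
Qed.

Lemma powser_euler (A : nat -> C) (z : C) :
  tempered A -> (Cmod z < 1)%R -> powser (euler_coef A) z = z * powser (dcoef A) z.
Proof.
  intros HA Hz. apply is_series_cseries. apply is_series_mul_id.
  - apply (is_series_powser (dcoef A)); [now apply tempered_dcoef|exact Hz].
  - unfold euler_coef. simpl. ring.
Qed.

(** The Taylor remainder of z^n satisfies E(n+1) = (z+h) E(n) + n z^(n-1) h^2,
    which gives a bound that is quadratic in h and summable against a tempered
    sequence. *)
Lemma pow_taylor_bound (z h : C) (r : R) (n : nat) :
  (Cmod z <= r)%R -> (Cmod (z + h) <= r)%R ->
  (Cmod ((z + h) ^ n - z ^ n - INR n * z ^ pred n * h) * r ^ 2
   <= INR n * INR n * r ^ n * Cmod h ^ 2)%R.
Proof.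
  intros Hz Hzh.
  assert (Hr : (0 <= r)%R) by (eapply Rle_trans; [apply Cmod_ge_0|exact Hz]).
  induction n as [|n IH].
  - simpl (INR 0). replace ((z + h) ^ 0 - z ^ 0 - 0 * z ^ pred 0 * h) with (RtoC 0)
      by (simpl; ring).
    rewrite Cmod_0. lra.
  - set (E := (z + h) ^ n - z ^ n - INR n * z ^ pred n * h) in *.
    assert (EE : (z + h) ^ S n - z ^ S n - INR (S n) * z ^ pred (S n) * h
                 = (z + h) * E + INR n * z ^ pred n * h * h).
    { unfold E. rewrite S_INR, RtoC_plus.
      destruct n as [|m]; [simpl; ring|].
      simpl pred. rewrite !Cpow_S. ring. }
    rewrite EE.
    assert (Hp : (INR n * Cmod z ^ pred n * r ^ 2 <= INR n * (r ^ S n))%R).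
    { destruct n as [|m]; [simpl; lra|].
      rewrite Rmult_assoc. apply Rmult_le_compat_l; [apply pos_INR|].
      simpl pred. replace (r ^ S (S m))%R with (r ^ m * r ^ 2)%R by (simpl; ring).
      apply Rmult_le_compat_r; [apply pow_le; lra|].
      apply pow_incr. split; [apply Cmod_ge_0|exact Hz]. }
    assert (Hh : (0 <= Cmod h ^ 2)%R) by (apply pow_le, Cmod_ge_0).
    assert (HE : (Cmod (z + h) * Cmod E * r ^ 2
                  <= r * (INR n * INR n * r ^ n * Cmod h ^ 2))%R).
    { rewrite Rmult_assoc. apply Rmult_le_compat; auto using Cmod_ge_0.
      apply Rmult_le_pos; [apply Cmod_ge_0|apply pow_le; lra]. }
    apply Rle_trans with
      ((Cmod (z + h) * Cmod E + INR n * Cmod z ^ pred n * Cmod h * Cmod h) * r ^ 2)%R.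
    + apply Rmult_le_compat_r; [apply pow_le; lra|].
      eapply Rle_trans; [apply Cmod_triangle|].
      rewrite !Cmod_mult, Cmod_INR, Cmod_pow. lra.
    + assert (Hp2 : (INR n * Cmod z ^ pred n * r ^ 2 * Cmod h ^ 2
                <= INR n * r ^ S n * Cmod h ^ 2)%R) by now apply Rmult_le_compat_r.
      assert (Hq : (0 <= (INR n + 1) * r ^ S n * Cmod h ^ 2)%R).
      { apply Rmult_le_pos; [|exact Hh]. apply Rmult_le_pos; [|apply pow_le; lra].
        pose proof (pos_INR n); lra. }
      rewrite S_INR.
      replace ((INR n + 1) * (INR n + 1) * r ^ S n * Cmod h ^ 2)%R
        with (r * (INR n * INR n * r ^ n * Cmod h ^ 2) + INR n * r ^ S n * Cmod h ^ 2
              + (INR n + 1) * r ^ S n * Cmod h ^ 2)%R by (simpl; ring).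
      lra.
Qed.

(** The epsilon-delta form of complex differentiability; the plane carries two
    uniform structures, balls and boxes, and this form mentions neither. *)
Definition cdiff (f : C -> C) (z l : C) : Prop :=
  forall eps, (0 < eps)%R -> exists delta, (0 < delta)%R /\
    forall h, (Cmod h < delta)%R -> (Cmod (f (z + h)%C - f z - l * h) <= eps * Cmod h)%R.

Lemma cdiff_is_derive (f : C -> C) (z l : C) : cdiff f z l -> is_derive f z l.
Proof.
  intros H. split; [apply is_linear_scal_l|].
  intros x Hx eps.
  assert (Ex : z = x) by (apply (@is_filter_lim_locally_unique C_AbsRing (AbsRing_NormedModule C_AbsRing) z x), Hx). subst x.
  destruct (H eps (cond_pos eps)) as [delta [Hd Hh]].
  exists (mkposreal delta Hd). intros y Hy.
  change (Cmod (y - z) < delta)%R in Hy.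
  change C in y. specialize (Hh (y - z) Hy).
  replace (z + (y - z)) with y in Hh by ring.
  change (Cmod (f y - f z - (y - z) * l) <= eps * Cmod (y - z))%R.
  now replace ((y - z) * l) with (l * (y - z)) by ring.
Qed.

(** The increment minus its linear part is the series of the A(n) E(n), where E(n)
    are the remainders of [pow_taylor_bound]; it is dominated by
    |h|^2 sum n^2 |A(n)| r^(n-2). *)
Lemma cdiff_powser (A : nat -> C) (z : C) :
  tempered A -> (Cmod z < 1)%R -> cdiff (powser A) z (powser (dcoef A) z).
Proof.
  intros HA Hz eps Heps.
  pose proof (Cmod_ge_0 z) as Hz0.
  set (r := ((1 + Cmod z) / 2)%R).
  assert (Hr : (0 < r < 1)%R) by (unfold r; lra).
  set (B := euler_coef (euler_coef A)).
  assert (HB : tempered B) by now do 2 apply tempered_euler_coef.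
  set (M := Series (fun n => Cmod (B n) * r ^ n)%R).
  assert (HM : ex_series (fun n => Cmod (B n) * r ^ n)%R)
    by (apply tempered_ex_series; [exact HB|lra]).
  set (K := (Rabs M / r ^ 2 + 1)%R).
  assert (Hr2 : (0 < r ^ 2)%R) by (apply pow_lt; lra).
  assert (HK : (0 < K)%R).
  { unfold K. assert (0 <= Rabs M / r ^ 2)%R; [|lra].
    apply Rmult_le_pos; [apply Rabs_pos|apply Rlt_le, Rinv_0_lt_compat, Hr2]. }
  exists (Rmin (r - Cmod z) (eps / K)). split.
  { apply Rmin_pos; [unfold r; lra|apply Rdiv_lt_0_compat; lra]. }
  intros h Hh.
  assert (Hh1 : (Cmod h < r - Cmod z)%R) by (eapply Rlt_le_trans; [exact Hh|apply Rmin_l]).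
  assert (Hh2 : (Cmod h < eps / K)%R) by (eapply Rlt_le_trans; [exact Hh|apply Rmin_r]).
  assert (Hzh : (Cmod (z + h) <= r)%R)
    by (eapply Rle_trans; [apply Cmod_triangle|lra]).
  set (u := fun n => A n * ((z + h) ^ n - z ^ n - INR n * z ^ pred n * h)).
  assert (S1 : is_series u (powser A (z + h)%C - powser A z - powser (dcoef A) z * h)).
  { assert (S3 : is_series (fun n => A n * (INR n * z ^ pred n * h))
                   (powser (dcoef A) z * h)).
    { apply (is_series_decr_1 (fun n => A n * (INR n * z ^ pred n * h))).
      match goal with |- is_series _ ?l =>
        replace l with (scal h (powser (dcoef A) z)) end.
      - eapply is_series_ext;
          [|apply (is_series_scal h _ _
              (is_series_powser (dcoef A) z (tempered_dcoef A HA) Hz))].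
        intros n. unfold dcoef. simpl pred.
        change (h * (INR (S n) * A (S n) * z ^ n) = A (S n) * (INR (S n) * z ^ n * h)).
        ring.
      - change (h * powser (dcoef A) z
          = powser (dcoef A) z * h - A O * (0 * z ^ pred 0 * h)).
        simpl. ring. }
    assert (S2 : is_series (fun n => A n * (z + h) ^ n) (powser A (z + h)%C))
      by (apply is_series_powser; [exact HA|lra]).
    pose proof (is_series_powser A z HA Hz) as S0.
    eapply is_series_ext;
      [|apply (is_series_minus _ _ _ _ (is_series_minus _ _ _ _ S2 S0) S3)].
    intros n. unfold u.
    change (A n * (z + h) ^ n - A n * z ^ n - A n * (INR n * z ^ pred n * h)
      = A n * ((z + h) ^ n - z ^ n - INR n * z ^ pred n * h)). ring. }
  assert (Hdom : forall n, (Cmod (u n)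
     <= Cmod h ^ 2 / r ^ 2 * (Cmod (B n) * r ^ n))%R).
  { intros n. unfold u. rewrite Cmod_mult.
    apply Rmult_le_reg_r with (r ^ 2)%R; [exact Hr2|].
    replace (Cmod h ^ 2 / r ^ 2 * (Cmod (B n) * r ^ n) * r ^ 2)%R
      with (Cmod (A n) * (INR n * INR n * r ^ n * Cmod h ^ 2))%R.
    - rewrite Rmult_assoc. apply Rmult_le_compat_l; [apply Cmod_ge_0|].
      apply pow_taylor_bound; unfold r in *; lra.
    - unfold B, euler_coef. rewrite !Cmod_mult, Cmod_INR. field. lra. }
  destruct (cseries_dominated u _ Hdom) as [_ Hle].
  { now apply (ex_series_scal_l (Cmod h ^ 2 / r ^ 2)%R (fun n => Cmod (B n) * r ^ n)%R). }
  rewrite (is_series_cseries _ _ S1) in Hle.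
  eapply Rle_trans; [exact Hle|].
  rewrite Series_scal_l. fold M.
  pose proof (Cmod_ge_0 h) as Hh0.
  assert (H3 : (Cmod h * K <= eps)%R).
  { apply Rlt_le. apply Rmult_lt_reg_r with (/ K)%R; [now apply Rinv_0_lt_compat|].
    rewrite Rmult_assoc, Rinv_r by lra. unfold Rdiv in Hh2. lra. }
  apply Rle_trans with (Cmod h * K * Cmod h)%R; [|now apply Rmult_le_compat_r].
  replace (Cmod h ^ 2 / r ^ 2 * M)%R with (Cmod h * (M / r ^ 2) * Cmod h)%R by (field; lra).
  apply Rmult_le_compat_r; [exact Hh0|]. apply Rmult_le_compat_l; [exact Hh0|].
  unfold K. assert (M / r ^ 2 <= Rabs M / r ^ 2)%R; [|lra].
  apply Rmult_le_compat_r; [apply Rlt_le, Rinv_0_lt_compat, Hr2|apply Rle_abs].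
Qed.

Lemma cdiff_mul_id (f : C -> C) (z l : C) :
  cdiff f z l -> cdiff (fun w => w * f w) z (f z + z * l).
Proof.
  intros H eps Heps.
  set (K := (1 + Cmod l + 1 + Cmod z)%R).
  assert (HK : (2 <= K)%R)
    by (unfold K; pose proof (Cmod_ge_0 l); pose proof (Cmod_ge_0 z); lra).
  assert (He : (0 < Rmin 1 (eps / (2 * K)))%R)
    by (apply Rmin_pos; [lra|apply Rdiv_lt_0_compat; lra]).
  destruct (H _ He) as [d [Hd Hh]].
  exists (Rmin d (Rmin 1 (eps / (2 * K)))).
  split; [now apply Rmin_pos|]. intros h Hhd.
  assert (H1 : (Cmod h < d)%R) by (eapply Rlt_le_trans; [exact Hhd|apply Rmin_l]).
  assert (H2 : (Cmod h < Rmin 1 (eps / (2 * K)))%R)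
    by (eapply Rlt_le_trans; [exact Hhd|apply Rmin_r]).
  specialize (Hh h H1). pose proof (Rmin_l 1 (eps / (2 * K))) as M1.
  pose proof (Rmin_r 1 (eps / (2 * K))) as M2.
  set (m := Rmin 1 (eps / (2 * K))) in *.
  set (E := f (z + h)%C - f z - l * h) in *.
  replace ((z + h) * f (z + h)%C - z * f z - (f z + z * l) * h)
    with ((z + h) * E + l * h * h) by (unfold E; ring).
  eapply Rle_trans; [apply Cmod_triangle|]. rewrite !Cmod_mult.
  pose proof (Cmod_ge_0 h) as Hh0. pose proof (Cmod_ge_0 z). pose proof (Cmod_ge_0 l).
  pose proof (Cmod_ge_0 E).
  pose proof (Cmod_triangle z h) as Ht.
  assert (X1 : (Cmod (z + h) * Cmod E <= K * (m * Cmod h))%R).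
  { apply Rmult_le_compat; auto using Cmod_ge_0. unfold K. lra. }
  assert (X2 : (Cmod l * Cmod h * Cmod h <= K * m * Cmod h)%R).
  { apply Rmult_le_compat_r; [lra|]. apply Rmult_le_compat; unfold K; lra. }
  assert (X3 : (K * m <= eps / 2)%R).
  { apply Rle_trans with (K * (eps / (2 * K)))%R; [apply Rmult_le_compat_l; lra|].
    right. field. lra. }
  assert (X4 : (K * m * Cmod h <= eps / 2 * Cmod h)%R) by (apply Rmult_le_compat_r; lra).
  lra.
Qed.

(** * The hypergeometric series and its differential equation *)

Definition hyp_coef (a b c : C) (n : nat) : C :=
  pochhammer a n * pochhammer b n / (pochhammer c n * INR (fact n)).

Lemma hyp2F1_powser (a b c z : C) : hyp2F1 a b c z = powser (hyp_coef a b c) z.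
Proof. reflexivity. Qed.

Lemma plus_INR_neq_0 (c : C) (n : nat) : c <> - INR n -> c + INR n <> 0.
Proof.
  intros H E. apply H. replace c with (c + INR n - INR n) by ring. rewrite E. ring.
Qed.

Lemma pochhammer_neq_0 (c : C) (n : nat) :
  (forall n : nat, c <> - INR n) -> pochhammer c n <> 0.
Proof.
  intros Hc. induction n as [|n IH]; simpl.
  - apply C1_nz.
  - apply Cmult_neq_0; [exact IH|]. now apply plus_INR_neq_0.
Qed.

Lemma hyp_coef_succ (a b c : C) (n : nat) : (forall n : nat, c <> - INR n) ->
  INR (S n) * (c + INR n) * hyp_coef a b c (S n)
  = (a + INR n) * (b + INR n) * hyp_coef a b c n.
Proof.
  intros Hc. unfold hyp_coef.
  change (pochhammer a (S n)) with (pochhammer a n * (a + INR n)).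
  change (pochhammer b (S n)) with (pochhammer b n * (b + INR n)).
  change (pochhammer c (S n)) with (pochhammer c n * (c + INR n)).
  rewrite fact_simpl, mult_INR, RtoC_mult.
  pose proof (pochhammer_neq_0 c n Hc) as H1.
  pose proof (plus_INR_neq_0 c n (Hc n)) as H2.
  assert (H3 : RtoC (INR (S n)) <> 0) by (intros E; apply RtoC_inj in E; revert E; apply not_0_INR; lia).
  assert (H4 : RtoC (INR (fact n)) <> 0) by (intros E; apply RtoC_inj in E; revert E; apply INR_fact_neq_0).
  field. auto.
Qed.

(** The ratio of consecutive coefficients tends to 1, so that A(n) r^n is
    eventually decreasing for every r < 1. *)
Lemma tempered_hyp_coef (a b c : C) :
  (forall n : nat, c <> - INR n) -> tempered (hyp_coef a b c).
Proof.
  intros Hc r Hr. set (A := hyp_coef a b c).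
  set (ka := Cmod a). set (kb := Cmod b). set (kc := Cmod c).
  assert (Ka : (0 <= ka)%R) by apply Cmod_ge_0.
  assert (Kb : (0 <= kb)%R) by apply Cmod_ge_0.
  assert (Kc : (0 <= kc)%R) by apply Cmod_ge_0.
  destruct (nfloor_ex ((ka + kb + 2 * kc + ka * kb) / (1 - r))) as [N [_ HN]].
  { apply Rmult_le_pos; [|apply Rlt_le, Rinv_0_lt_compat; lra].
    pose proof (Rmult_le_pos ka kb Ka Kb). lra. }
  assert (Hstep : forall n, (S N <= n)%nat -> (Cmod (A (S n)) * r <= Cmod (A n))%R).
  { intros n Hn.
    assert (Hn1 : (ka + kb + 2 * kc + ka * kb < INR n * (1 - r))%R).
    { apply Rmult_lt_reg_r with (/ (1 - r))%R; [apply Rinv_0_lt_compat; lra|].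
      rewrite Rmult_assoc, Rinv_r, Rmult_1_r by lra.
      apply Rlt_le_trans with (INR N + 1)%R; [exact HN|].
      rewrite <- S_INR. now apply le_INR. }
    assert (Hn2 : (1 <= INR n)%R) by (apply (le_INR 1); lia).
    pose proof (f_equal Cmod (hyp_coef_succ a b c n Hc)) as E. fold A in E.
    rewrite !Cmod_mult, Cmod_INR in E.
    assert (Ea : (Cmod (a + INR n) <= ka + INR n)%R)
      by (eapply Rle_trans; [apply Cmod_triangle|rewrite Cmod_INR; apply Rle_refl]).
    assert (Eb : (Cmod (b + INR n) <= kb + INR n)%R)
      by (eapply Rle_trans; [apply Cmod_triangle|rewrite Cmod_INR; apply Rle_refl]).
    assert (Ec : (INR n - kc <= Cmod (c + INR n))%R).
    { pose proof (Cmod_triangle (c + INR n) (- c)) as Ht.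
      replace (c + INR n + - c) with (RtoC (INR n)) in Ht by ring.
      rewrite Cmod_INR, Cmod_opp in Ht. fold kc in Ht. lra. }
    rewrite S_INR in E. set (x := INR n) in *. set (A1 := Cmod (A (S n))) in *.
    set (A0 := Cmod (A n)) in *.
    assert (HA1 : (0 <= A1)%R) by apply Cmod_ge_0.
    assert (HA0 : (0 <= A0)%R) by apply Cmod_ge_0.
    pose proof (Cmod_ge_0 (a + x)). pose proof (Cmod_ge_0 (b + x)).
    assert (P0 : (0 <= ka * kb)%R) by now apply Rmult_le_pos.
    assert (X1 : (x - kc > 0)%R) by nra.
    assert (X2 : ((ka + x) * (kb + x) * r <= (x + 1) * (x - kc))%R).
    { assert (x * (ka + kb + 2 * kc + ka * kb) <= x * (x * (1 - r)))%R
        by (apply Rmult_le_compat_l; lra).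
      assert (ka * kb * r <= ka * kb * x)%R by (apply Rmult_le_compat_l; lra).
      assert ((ka + kb) * x * r <= (ka + kb) * x * 1)%R.
      { apply Rmult_le_compat_l; [|lra]. apply Rmult_le_pos; lra. }
      assert (kc * 1 <= kc * x)%R by (apply Rmult_le_compat_l; lra). nra. }
    apply Rmult_le_reg_l with ((x + 1) * (x - kc))%R; [nra|].
    apply Rle_trans with ((ka + x) * (kb + x) * A0 * r)%R.
    - rewrite <- Rmult_assoc. apply Rmult_le_compat_r; [lra|].
      apply Rle_trans with ((x + 1) * Cmod (c + x) * A1)%R.
      + apply Rmult_le_compat_r; [exact HA1|]. apply Rmult_le_compat_l; lra.
      + rewrite E. apply Rmult_le_compat_r; [exact HA0|].
        apply Rmult_le_compat; assumption.
    - replace ((ka + x) * (kb + x) * A0 * r)%R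
        with ((ka + x) * (kb + x) * r * A0)%R by ring.
      now apply Rmult_le_compat_r. }
  assert (Hinit : forall m, exists M, forall n, (n <= m)%nat -> (Cmod (A n) * r ^ n <= M)%R).
  { induction m as [|m [M HM]].
    - exists (Cmod (A O) * r ^ 0)%R. intros n Hn. replace n with O by lia. lra.
    - exists (Rmax M (Cmod (A (S m)) * r ^ S m)%R). intros n Hn.
      destruct (Nat.eq_dec n (S m)) as [->|Hne]; [apply Rmax_r|].
      eapply Rle_trans; [apply HM; lia|apply Rmax_l]. }
  destruct (Hinit (S N)) as [M HM]. exists M.
  induction n as [|n IH]; [apply HM; lia|].
  destruct (Compare_dec.le_lt_dec (S n) (S N)) as [Hl|Hl]; [now apply HM|].
  apply Rle_trans with (Cmod (A n) * r ^ n)%R; [|exact IH].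
  simpl. rewrite <- Rmult_assoc. apply Rmult_le_compat_r; [apply pow_le; lra|].
  apply Hstep. lia.
Qed.

(** Comparing coefficients in theta (theta + c - 1) F = z (theta + a) (theta + b) F,
    where theta = z d/dz. *)
Lemma hyp_euler_equation (a b c z : C) :
  (forall n : nat, c <> - INR n) -> (Cmod z < 1)%R ->
  let A := hyp_coef a b c in
  let F0 := powser A z in
  let T1 := powser (euler_coef A) z in
  let T2 := powser (euler_coef (euler_coef A)) z in
  T2 + (c - 1) * T1 = z * (T2 + (a + b) * T1 + a * b * F0).
Proof.
  intros Hc Hz A F0 T1 T2.
  pose proof (tempered_hyp_coef a b c Hc) as H0. fold A in H0.
  pose proof (tempered_euler_coef A H0) as H1.
  pose proof (tempered_euler_coef _ H1) as H2.
  pose proof (is_series_powser _ z H0 Hz) as S0.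
  pose proof (is_series_powser _ z H1 Hz) as S1.
  pose proof (is_series_powser _ z H2 Hz) as S2.
  set (L := fun n => euler_coef (euler_coef A) n + (c - 1) * euler_coef A n).
  assert (SL : is_series (fun n => L n * z ^ n) (T2 + (c - 1) * T1)).
  { eapply is_series_ext;
      [|apply (is_series_plus _ _ _ _ S2 (is_series_scal (c - 1) _ _ S1))].
    intros n. unfold L.
    change (euler_coef (euler_coef A) n * z ^ n + (c - 1) * (euler_coef A n * z ^ n)
            = (euler_coef (euler_coef A) n + (c - 1) * euler_coef A n) * z ^ n). ring. }
  assert (SR : is_series (fun n => L (S n) * z ^ n) (T2 + (a + b) * T1 + a * b * F0)).
  { eapply is_series_ext;
      [|apply (is_series_plus _ _ _ _
                 (is_series_plus _ _ _ _ S2 (is_series_scal (a + b) _ _ S1))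
                 (is_series_scal (a * b) _ _ S0))].
    intros n. unfold L.
    change (euler_coef (euler_coef A) n * z ^ n + (a + b) * (euler_coef A n * z ^ n)
            + a * b * (A n * z ^ n)
            = (euler_coef (euler_coef A) (S n) + (c - 1) * euler_coef A (S n)) * z ^ n).
    unfold euler_coef.
    replace (INR (S n) * (INR (S n) * A (S n)) + (c - 1) * (INR (S n) * A (S n)))
      with (INR (S n) * (c + INR n) * A (S n))
      by (rewrite S_INR, RtoC_plus; ring).
    unfold A at 4. rewrite hyp_coef_succ by exact Hc. fold A. ring. }
  rewrite <- (is_series_cseries _ _ SL). apply is_series_cseries.
  apply is_series_mul_id; [exact SR|].
  unfold L, euler_coef. simpl. ring.
Qed.

(** * Compactness in the plane *)

Lemma Cmod_le_abs (z : C) : (Cmod z <= Rabs (fst z) + Rabs (snd z))%R.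
Proof.
  pose proof (Rabs_pos (fst z)). pose proof (Rabs_pos (snd z)).
  apply Rsqr_incr_0_var; [|lra].
  pose proof (Cmod2_alt z) as E. unfold Re, Im in E. unfold Rsqr.
  rewrite <- (pow2_abs (fst z)), <- (pow2_abs (snd z)) in E. nra.
Qed.

(** The shape of the conclusion, d <= delta at a centre of the cover, lets P carry
    numerical information from one centre to the whole disk. *)
Lemma lebesgue_number (M : R) (P : C -> R -> Prop) :
  (forall z, exists delta, (0 < delta)%R /\ P z delta) ->
  exists d, (0 < d)%R /\ forall x, (Cmod x <= M)%R ->
    exists z delta, P z delta /\ (Cmod (x - z) < delta)%R /\ (d <= delta)%R.
Proof.
  intros HP.
  assert (Hc : forall u v : R, {delta : posreal | P (u, v) delta}).
  { intros u v. apply constructive_indefinite_description.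
    destruct (HP (u, v)) as [delta [H1 H2]]. now exists (mkposreal delta H1). }
  pose (g := fun u v => mkposreal (proj1_sig (Hc u v) / 2)
                (is_pos_div_2 (proj1_sig (Hc u v)))).
  destruct (compactness_value_2d (- M) M (- M) M g) as [d Hd].
  exists d. split; [apply cond_pos|]. intros x Hx.
  pose proof (Rmax_Cmod x) as Hm.
  pose proof (Rmax_l (Rabs (fst x)) (Rabs (snd x))) as H1.
  pose proof (Rmax_r (Rabs (fst x)) (Rabs (snd x))) as H2.
  assert (B1 : (- M <= fst x <= M)%R) by (apply Rabs_le_between; lra).
  assert (B2 : (- M <= snd x <= M)%R) by (apply Rabs_le_between; lra).
  destruct (NNPP _ (Hd (fst x) (snd x) B1 B2)) as (u & v & _ & _ & Hu & Hv & Hdd).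
  exists (u, v), (proj1_sig (Hc u v)). unfold g in *; simpl in *.
  split; [apply (proj2_sig (Hc u v))|].
  pose proof (cond_pos (proj1_sig (Hc u v))) as Hp.
  split; [|lra].
  eapply Rle_lt_trans; [apply Cmod_le_abs|]. simpl.
  unfold Rminus in Hu, Hv. lra.
Qed.

(** If the supremum m of f were not attained, cover K by neighbourhoods of z of
    radius at most (m - f(z))/2 on which f increases by at most that much: a Lebesgue
    number d then gives f <= m - d. *)
Lemma compact_max (K : C -> Prop) (f : C -> R) (M : R) :
  (forall z, K z -> (Cmod z <= M)%R) ->
  (forall z, ~ K z -> exists d, (0 < d)%R /\ forall w, (Cmod (w - z) < d)%R -> ~ K w) ->
  (exists z, K z) ->
  (forall z, K z -> forall eps, (0 < eps)%R -> exists d, (0 < d)%R /\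
     forall w, K w -> (Cmod (w - z) < d)%R -> (f w < f z + eps)%R) ->
  exists z, K z /\ forall w, K w -> (f w <= f z)%R.
Proof.
  intros Hb Hcl [z0 Hz0] Hf.
  (* [e] bounds both the size of a neighbourhood of z and the increase of f on
     it, so that a Lebesgue number turns into an estimate for f *)
  assert (Hcover : forall e : C -> R, (forall z, K z -> (0 < e z)%R) ->
    exists d, (0 < d)%R /\ forall w, K w -> exists z, K z /\
      (f w < f z + e z)%R /\ (d <= e z)%R).
  { intros e He.
    destruct (lebesgue_number M (fun z delta =>
      (K z /\ (delta <= e z)%R /\
         forall w, K w -> (Cmod (w - z) < delta)%R -> (f w < f z + e z)%R) \/
      (forall w, (Cmod (w - z) < delta)%R -> ~ K w))) as [d [Hd Hl]].
    - intros z. destruct (classic (K z)) as [Hz|Hz].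
      + destruct (Hf z Hz (e z) (He z Hz)) as [d [Hd Hw]].
        exists (Rmin d (e z)). split; [apply Rmin_pos; auto|].
        left. split; [exact Hz|]. split; [apply Rmin_r|].
        intros w HKw Hlt. apply Hw; [exact HKw|].
        eapply Rlt_le_trans; [exact Hlt|apply Rmin_l].
      + destruct (Hcl z Hz) as [d [Hd Hw]]. exists d. split; [exact Hd|now right].
    - exists d. split; [exact Hd|]. intros w Hw.
      destruct (Hl w (Hb w Hw)) as (z & delta & [(Hz & Hle & Hzw)|Hn] & Hlt & Hdd).
      + exists z. split; [exact Hz|]. split; [now apply Hzw|lra].
      + exfalso. now apply (Hn w Hlt). }
  apply NNPP. intros Hno.
  assert (Hbig : forall z, K z -> exists w, K w /\ (f z < f w)%R).
  { intros z Hz. apply NNPP. intros Hn. apply Hno. exists z. split; [exact Hz|].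
    intros w Hw. apply Rnot_lt_le. intros Hlt. apply Hn. now exists w. }
  assert (Hbd : bound (fun y => exists z, K z /\ y = f z)).
  { destruct (Hcover (fun z => / (Rabs (f z) + 1))%R) as [d [Hd Hc]].
    { intros z _. apply Rinv_0_lt_compat. pose proof (Rabs_pos (f z)). lra. }
    exists (/ d + 1)%R. intros y (w & Hw & ->).
    destruct (Hc w Hw) as (z & Hz & H1 & H2).
    pose proof (Rabs_pos (f z)) as Hp. pose proof (Rle_abs (f z)) as Hp2.
    assert (H3 : (Rabs (f z) + 1 <= / d)%R).
    { rewrite <- (Rinv_inv (Rabs (f z) + 1)). now apply Rinv_le_contravar. }
    assert (H4 : (/ (Rabs (f z) + 1) <= 1)%R).
    { rewrite <- Rinv_1 at 2. apply Rinv_le_contravar; lra. }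
    lra. }
  destruct (completeness _ Hbd) as [m [Hm1 Hm2]].
  { exists (f z0), z0. auto. }
  assert (Hlt : forall z, K z -> (f z < m)%R).
  { intros z Hz. destruct (Hbig z Hz) as (w & Hw & Hzw).
    apply Rlt_le_trans with (f w); [exact Hzw|]. apply Hm1. now exists w. }
  destruct (Hcover (fun z => (m - f z) / 2)%R) as [d [Hd Hc]].
  { intros z Hz. specialize (Hlt z Hz). lra. }
  assert (Hub : is_upper_bound (fun y => exists z, K z /\ y = f z) (m - d)).
  { intros y (w & Hw & ->). destruct (Hc w Hw) as (z & Hz & H1 & H2). lra. }
  specialize (Hm2 _ Hub). lra.
Qed.

(** * Complex derivatives along real lines *)

(** Derivative along the real lines through z only. Its rules are those of real
    calculus for the components, which also covers the branch of a power, and the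
    maximum principle requires nothing more. *)
Definition cder (f : C -> C) (z l : C) : Prop :=
  forall d : C,
    is_derive (fun t : R => Re (f (z + t * d))) 0%R (Re (l * d)) /\
    is_derive (fun t : R => Im (f (z + t * d))) 0%R (Im (l * d)).

Lemma is_derive_from_bound (g : R -> R) (t l : R) :
  (forall eps, (0 < eps)%R -> exists delta, (0 < delta)%R /\ forall h, (Rabs h < delta)%R ->
     (Rabs (g (t + h) - g t - l * h) <= eps * Rabs h)%R) ->
  is_derive g t l.
Proof.
  intros H. apply is_derive_Reals. intros eps Heps.
  destruct (H (eps / 2)%R) as [d [Hd Hh]]; [lra|].
  exists (mkposreal d Hd). intros h Hh0 Hhd. simpl in Hhd.
  specialize (Hh h Hhd).
  assert (Hp : (0 < Rabs h)%R) by now apply Rabs_pos_lt.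
  replace ((g (t + h) - g t) / h - l)%R with ((g (t + h) - g t - l * h) / h)%R
    by (field; exact Hh0).
  unfold Rdiv. rewrite Rabs_mult, Rabs_inv.
  apply Rle_lt_trans with (eps / 2)%R; [|lra].
  apply Rmult_le_reg_r with (Rabs h); [exact Hp|].
  rewrite Rmult_assoc, Rinv_l by lra. lra.
Qed.

Lemma Rabs_Re_le (w : C) : (Rabs (Re w) <= Cmod w)%R.
Proof. apply re_le_Cmod. Qed.

Lemma Rabs_Im_le (w : C) : (Rabs (Im w) <= Cmod w)%R.
Proof.
  eapply Rle_trans; [|apply (Rmax_Cmod w)]. apply Rmax_r.
Qed.

Lemma cdiff_cder (f : C -> C) (z l : C) : cdiff f z l -> cder f z l.
Proof.
  intros H d.
  assert (HB : forall eps, (0 < eps)%R -> exists delta, (0 < delta)%R /\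
    forall h : R, (Rabs h < delta)%R ->
      (Cmod (f (z + (0 + h)%R * d)%C - f (z + 0%R * d)%C - h * (l * d)) <= eps * Rabs h)%R).
  { intros eps Heps.
    set (k := (Cmod d + 1)%R).
    assert (Hk : (0 < k)%R) by (unfold k; pose proof (Cmod_ge_0 d); lra).
    destruct (H (eps / k)%R) as [delta [Hd Hh]]; [now apply Rdiv_lt_0_compat|].
    exists (delta / k)%R. split; [now apply Rdiv_lt_0_compat|].
    intros h Hhd.
    assert (E : Cmod (h * d) = (Rabs h * Cmod d)%R) by now rewrite Cmod_mult, Cmod_R.
    pose proof (Rabs_pos h) as Hp. pose proof (Cmod_ge_0 d) as Hpd.
    assert (Hle : (Rabs h * Cmod d <= Rabs h * k)%R)
      by (apply Rmult_le_compat_l; unfold k; lra).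
    assert (Hlt : (Rabs h * k < delta)%R).
    { apply Rmult_lt_reg_r with (/ k)%R; [now apply Rinv_0_lt_compat|].
      rewrite Rmult_assoc, Rinv_r by lra. unfold Rdiv in Hhd. lra. }
    specialize (Hh (h * d)).
    rewrite E in Hh. specialize (Hh ltac:(lra)).
    replace (z + (0 + h)%R * d) with (z + h * d) by (rewrite Rplus_0_l; reflexivity).
    replace (z + 0%R * d) with z by ring.
    replace (h * (l * d)) with (l * (h * d)) by ring.
    eapply Rle_trans; [exact Hh|].
    replace (eps * Rabs h)%R with (eps / k * (Rabs h * k))%R by (field; lra).
    apply Rmult_le_compat_l; [|exact Hle]. apply Rlt_le, Rdiv_lt_0_compat; lra. }
  split; apply is_derive_from_bound; intros eps Heps;
    destruct (HB eps Heps) as [delta [Hd Hh]]; exists delta; (split; [exact Hd|]);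
    intros h Hhd; (eapply Rle_trans; [|apply (Hh h Hhd)]).
  - eapply Rle_trans; [|apply Rabs_Re_le]. right. f_equal.
    unfold Re. simpl. ring.
  - eapply Rle_trans; [|apply Rabs_Im_le]. right. f_equal.
    unfold Im. simpl. ring.
Qed.

Lemma cder_line (f : C -> C) (z d l : C) (t0 : R) :
  cder f (z + t0 * d) l ->
  is_derive (fun t : R => Re (f (z + t * d))) t0 (Re (l * d)) /\
  is_derive (fun t : R => Im (f (z + t * d))) t0 (Im (l * d)).
Proof.
  intros H. destruct (H d) as [H1 H2].
  assert (Hs : is_derive (fun t : R => (t - t0)%R) t0 1%R)
    by (auto_derive; [exact I|ring]).
  replace 0%R with (t0 - t0)%R in H1, H2 by ring.
  split.
  - pose proof (is_derive_comp _ (fun t => t - t0)%R _ _ _ H1 Hs) as HH.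
    replace (Re (l * d)) with (scal (V := R_NormedModule) 1%R (Re (l * d)))
      by (change (1 * Re (l * d) = Re (l * d))%R; ring).
    eapply is_derive_ext; [|exact HH]. intros t. simpl. f_equal. f_equal.
    rewrite RtoC_minus. ring.
  - pose proof (is_derive_comp _ (fun t => t - t0)%R _ _ _ H2 Hs) as HH.
    replace (Im (l * d)) with (scal (V := R_NormedModule) 1%R (Im (l * d)))
      by (change (1 * Im (l * d) = Im (l * d))%R; ring).
    eapply is_derive_ext; [|exact HH]. intros t. simpl. f_equal. f_equal.
    rewrite RtoC_minus. ring.
Qed.

Lemma cder_const (k z : C) : cder (fun _ => k) z 0.
Proof.
  intros d. split; (auto_derive; [exact I|simpl; ring]).
Qed.

Lemma cder_id (z : C) : cder (fun w => w) z 1.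
Proof.
  intros d. split; simpl; (auto_derive; [exact I|simpl; ring]).
Qed.

Ltac derive_from_components :=
  auto_derive;
  [ repeat split; try (eexists; eassumption); auto
  | repeat (erewrite is_derive_unique by eassumption) ].

Lemma cder_plus (f g : C -> C) (z lf lg : C) :
  cder f z lf -> cder g z lg -> cder (fun w => f w + g w) z (lf + lg).
Proof.
  intros Hf Hg d. destruct (Hf d) as [F1 F2]. destruct (Hg d) as [G1 G2].
  split.
  - change (is_derive (fun t : R => Re (f (z + t * d)%C) + Re (g (z + t * d)%C))%R 0%R
      (Re ((lf + lg) * d))).
    evar_last; [apply (is_derive_plus _ _ _ _ _ F1 G1)|simpl; unfold plus; simpl; ring].
  - change (is_derive (fun t : R => Im (f (z + t * d)%C) + Im (g (z + t * d)%C))%R 0%R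
      (Im ((lf + lg) * d))).
    evar_last; [apply (is_derive_plus _ _ _ _ _ F2 G2)|simpl; unfold plus; simpl; ring].
Qed.

Lemma cder_mult (f g : C -> C) (z lf lg : C) :
  cder f z lf -> cder g z lg -> cder (fun w => f w * g w) z (lf * g z + f z * lg).
Proof.
  intros Hf Hg d. destruct (Hf d) as [F1 F2]. destruct (Hg d) as [G1 G2].
  assert (Ez : z + 0%R * d = z) by ring.
  unfold Re, Im in *. simpl.
  set (x1 := fun t : R => fst (f (z + t * d))) in *.
  set (y1 := fun t : R => snd (f (z + t * d))) in *.
  set (x2 := fun t : R => fst (g (z + t * d))) in *.
  set (y2 := fun t : R => snd (g (z + t * d))) in *.
  assert (E1 : x1 0%R = fst (f z)) by (unfold x1; now rewrite Ez).
  assert (E2 : y1 0%R = snd (f z)) by (unfold y1; now rewrite Ez).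
  assert (E3 : x2 0%R = fst (g z)) by (unfold x2; now rewrite Ez).
  assert (E4 : y2 0%R = snd (g z)) by (unfold y2; now rewrite Ez).
  split.
  - change (is_derive (fun t => x1 t * x2 t - y1 t * y2 t)%R 0%R
     ((fst lf * fst (g z) - snd lf * snd (g z) + (fst (f z) * fst lg - snd (f z) * snd lg)) * fst d
      - (fst lf * snd (g z) + snd lf * fst (g z) + (fst (f z) * snd lg + snd (f z) * fst lg)) * snd d)%R).
    derive_from_components. rewrite E1, E2, E3, E4. simpl. ring.
  - change (is_derive (fun t => x1 t * y2 t + y1 t * x2 t)%R 0%R
     ((fst lf * fst (g z) - snd lf * snd (g z) + (fst (f z) * fst lg - snd (f z) * snd lg)) * snd d
      + (fst lf * snd (g z) + snd lf * fst (g z) + (fst (f z) * snd lg + snd (f z) * fst lg)) * fst d)%R).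
    derive_from_components. rewrite E1, E2, E3, E4. simpl. ring.
Qed.

Lemma sum_sqr_neq_0 (w : C) : w <> 0 -> (fst w ^ 2 + snd w ^ 2 <> 0)%R.
Proof.
  intros H E. apply H.
  assert (fst w = 0%R) by nra. assert (snd w = 0%R) by nra.
  now apply injective_projections.
Qed.

Lemma cder_inv (f : C -> C) (z l : C) :
  cder f z l -> f z <> 0 -> cder (fun w => / f w) z (- l / (f z * f z)).
Proof.
  intros Hf Hz d. destruct (Hf d) as [F1 F2].
  pose proof (sum_sqr_neq_0 _ Hz) as Hn.
  assert (Ez : z + 0%R * d = z) by ring.
  set (v := - l / (f z * f z) * d).
  assert (Ev : v = - (l * d) * (/ f z * / f z)) by (unfold v; field; exact Hz).
  unfold Re, Im in *.
  set (x1 := fun t : R => fst (f (z + t * d))) in *.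
  set (y1 := fun t : R => snd (f (z + t * d))) in *.
  assert (E1 : x1 0%R = fst (f z)) by (unfold x1; now rewrite Ez).
  assert (E2 : y1 0%R = snd (f z)) by (unfold y1; now rewrite Ez).
  set (dx := fst (l * d)) in *. set (dy := snd (l * d)) in *.
  split.
  - change (is_derive (fun t => x1 t / (x1 t ^ 2 + y1 t ^ 2))%R 0%R (fst v)).
    derive_from_components.
    + rewrite E1, E2. simpl in Hn. exact Hn.
    + rewrite E1, E2, Ev. simpl. fold dx dy.
      change (fst l * fst d - snd l * snd d)%R with dx.
      change (fst l * snd d + snd l * fst d)%R with dy.
      simpl in Hn. field. intros Hc. apply Hn. lra.
  - change (is_derive (fun t => - y1 t / (x1 t ^ 2 + y1 t ^ 2))%R 0%R (snd v)).
    derive_from_components.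
    + rewrite E1, E2. simpl in Hn. exact Hn.
    + rewrite E1, E2, Ev. simpl.
      change (fst l * fst d - snd l * snd d)%R with dx.
      change (fst l * snd d + snd l * fst d)%R with dy.
      simpl in Hn. field. intros Hc. apply Hn. lra.
Qed.

(** The branch of w^k on the right half-plane that is 1 at 1. *)
Definition rpow (k : R) (w : C) : C :=
  let x := exp (k * ln (Re w ^ 2 + Im w ^ 2) / 2) in
  let y := (k * atan (Im w / Re w))%R in
  (x * cos y, x * sin y)%R.

Lemma cder_rpow (k : R) (f : C -> C) (z l : C) :
  cder f z l -> (0 < Re (f z))%R ->
  cder (fun w => rpow k (f w)) z (k * rpow k (f z) * l / f z).
Proof.
  intros Hf Hz d. destruct (Hf d) as [F1 F2].
  assert (Hn : (0 < Re (f z) ^ 2 + Im (f z) ^ 2)%R) by nra.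
  assert (Ez : z + 0%R * d = z) by ring.
  set (v := k * rpow k (f z) * l / f z * d).
  assert (Ev : v = k * rpow k (f z) * (l * d) * / f z) by (unfold v, Cdiv; ring).
  unfold Re, Im in *.
  set (x1 := fun t : R => fst (f (z + t * d))) in *.
  set (y1 := fun t : R => snd (f (z + t * d))) in *.
  assert (E1 : x1 0%R = fst (f z)) by (unfold x1; now rewrite Ez).
  assert (E2 : y1 0%R = snd (f z)) by (unfold y1; now rewrite Ez).
  set (dx := fst (l * d)) in *. set (dy := snd (l * d)) in *.
  split.
  - change (is_derive (fun t => exp (k * ln (x1 t ^ 2 + y1 t ^ 2) / 2)
              * cos (k * atan (y1 t / x1 t)))%R 0%R (fst v)).
    derive_from_components.
    + rewrite E1, E2. simpl in Hn. lra.
    + rewrite E1. lra.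
    + rewrite E1, E2, Ev. unfold rpow, Re, Im. simpl.
      change (fst l * fst d - snd l * snd d)%R with dx.
      change (fst l * snd d + snd l * fst d)%R with dy.
      simpl in Hn. unfold Rdiv. field. split; apply Rgt_not_eq; lra.
  - change (is_derive (fun t => exp (k * ln (x1 t ^ 2 + y1 t ^ 2) / 2)
              * sin (k * atan (y1 t / x1 t)))%R 0%R (snd v)).
    derive_from_components.
    + rewrite E1, E2. simpl in Hn. lra.
    + rewrite E1. lra.
    + rewrite E1, E2, Ev. unfold rpow, Re, Im. simpl.
      change (fst l * fst d - snd l * snd d)%R with dx.
      change (fst l * snd d + snd l * fst d)%R with dy.
      simpl in Hn. unfold Rdiv. field. split; apply Rgt_not_eq; lra.
Qed.

(** * Mean value inequality and the Schwarz lemma *)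

Lemma Cmod_sqr (w : C) : (Cmod w * Cmod w = Re w * Re w + Im w * Im w)%R.
Proof. pose proof (Cmod2_alt w) as E. simpl in E. lra. Qed.

(** The real mean value theorem for the component of f in the direction of the
    increment f(z+h) - f(z). *)
Lemma cder_mean_value (f f1 : C -> C) (z h : C) (K : R) :
  (forall t : R, (0 <= t <= 1)%R -> cder f (z + t * h) (f1 (z + t * h))) ->
  (forall t : R, (0 <= t <= 1)%R -> (Cmod (f1 (z + t * h)%C) <= K)%R) ->
  (Cmod (f (z + h)%C - f z) <= K * Cmod h)%R.
Proof.
  intros Hd HK. set (w := f (z + h) - f z).
  set (phi := fun t : R => (Re w * Re (f (z + t * h)%C) + Im w * Im (f (z + t * h)%C))%R).
  assert (Hphi : forall t, (0 <= t <= 1)%R ->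
    is_derive phi t (Re w * Re (f1 (z + t * h)%C * h) + Im w * Im (f1 (z + t * h)%C * h))%R).
  { intros t Ht. destruct (cder_line f z h _ t (Hd t Ht)) as [H1 H2].
    apply (is_derive_plus (V := R_NormedModule)); now apply is_derive_scal. }
  destruct (MVT_gen phi 0 1
    (fun t => Re w * Re (f1 (z + t * h)%C * h) + Im w * Im (f1 (z + t * h)%C * h))%R)
    as [c [Hc1 Hc2]].
  - intros t Ht. rewrite Rmin_left, Rmax_right in Ht by lra. apply Hphi. lra.
  - intros t Ht. rewrite Rmin_left, Rmax_right in Ht by lra.
    apply continuity_pt_filterlim, (ex_derive_continuous phi t).
    eexists. apply Hphi. lra.
  - rewrite Rmin_left, Rmax_right in Hc1 by lra.
    assert (E : (phi 1 - phi 0 = Cmod w * Cmod w)%R).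
    { rewrite Cmod_sqr. unfold phi.
      replace (z + 1%R * h) with (z + h) by ring.
      replace (z + 0%R * h) with z by ring.
      unfold w, Re, Im. simpl. ring. }
    set (v := f1 (z + c * h) * h) in *.
    assert (Hv : (Cmod v <= K * Cmod h)%R).
    { unfold v. rewrite Cmod_mult. apply Rmult_le_compat_r; [apply Cmod_ge_0|now apply HK]. }
    assert (HCS : (Re w * Re v + Im w * Im v <= Cmod w * Cmod v)%R).
    { eapply Rle_trans; [|rewrite <- (Cmod_conj w), <- Cmod_mult; apply Rle_refl].
      eapply Rle_trans; [|apply Rabs_Re_le]. eapply Rle_trans; [|apply Rle_abs].
      right. unfold Re, Im. simpl. ring. }
    fold v in Hc2. rewrite E in Hc2. pose proof (Cmod_ge_0 w) as Hw.
    destruct (Req_dec (Cmod w) 0) as [H0|H0].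
    + rewrite H0. apply Rle_trans with (Cmod v); [apply Cmod_ge_0|exact Hv].
    + apply Rmult_le_reg_l with (Cmod w); [lra|].
      apply Rle_trans with (Cmod w * Cmod v)%R; [lra|now apply Rmult_le_compat_l].
Qed.

Definition locally_bounded (f : C -> C) (z : C) : Prop :=
  exists K delta, (0 < delta)%R /\
    forall w, (Cmod (w - z) < delta)%R -> (Cmod (f w) <= K)%R.

Definition ccont (f : C -> C) (z : C) : Prop :=
  forall eps, (0 < eps)%R -> exists delta, (0 < delta)%R /\
    forall w, (Cmod (w - z) < delta)%R -> (Cmod (f w - f z) < eps)%R.

Lemma cder_lipschitz (f f1 : C -> C) (z : C) (d0 : R) : (0 < d0)%R ->
  (forall w, (Cmod (w - z) < d0)%R -> cder f w (f1 w)) -> locally_bounded f1 z ->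
  exists K delta, (0 < K)%R /\ (0 < delta)%R /\
    forall w, (Cmod (w - z) < delta)%R -> (Cmod (f w - f z) <= K * Cmod (w - z))%R.
Proof.
  intros Hd0 Hd (K & d1 & Hd1 & HK).
  exists (Rabs K + 1)%R, (Rmin d0 d1). split; [pose proof (Rabs_pos K); lra|].
  split; [now apply Rmin_pos|]. intros w Hw.
  assert (Hseg : forall t : R, (0 <= t <= 1)%R -> (Cmod (z + t * (w - z) - z) < Rmin d0 d1)%R).
  { intros t Ht. replace (z + t * (w - z) - z) with (t * (w - z)) by ring.
    rewrite Cmod_mult, Cmod_R, Rabs_pos_eq by lra.
    eapply Rle_lt_trans; [|exact Hw].
    rewrite <- (Rmult_1_l (Cmod (w - z))) at 2.
    apply Rmult_le_compat_r; [apply Cmod_ge_0|lra]. }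
  pose proof (cder_mean_value f f1 z (w - z) (Rabs K + 1)) as HH.
  replace (z + (w - z)) with w in HH by ring. apply HH; intros t Ht; specialize (Hseg t Ht).
  - apply Hd. eapply Rlt_le_trans; [exact Hseg|apply Rmin_l].
  - eapply Rle_trans; [apply HK; eapply Rlt_le_trans; [exact Hseg|apply Rmin_r]|].
    pose proof (Rle_abs K). lra.
Qed.

Lemma cder_ccont (f f1 : C -> C) (z : C) (d0 : R) : (0 < d0)%R ->
  (forall w, (Cmod (w - z) < d0)%R -> cder f w (f1 w)) -> locally_bounded f1 z ->
  ccont f z.
Proof.
  intros Hd0 Hd Hb eps Heps.
  destruct (cder_lipschitz f f1 z d0 Hd0 Hd Hb) as (K & d & HK & Hdp & Hw).
  exists (Rmin d (eps / K)). split; [apply Rmin_pos; [exact Hdp|now apply Rdiv_lt_0_compat]|].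
  intros w Hlt. eapply Rle_lt_trans.
  - apply Hw. eapply Rlt_le_trans; [exact Hlt|apply Rmin_l].
  - assert (H2 : (Cmod (w - z) < eps / K)%R)
      by (eapply Rlt_le_trans; [exact Hlt|apply Rmin_r]).
    apply Rmult_lt_reg_r with (/ K)%R; [now apply Rinv_0_lt_compat|].
    replace (K * Cmod (w - z) * / K)%R with (Cmod (w - z)) by (field; lra). exact H2.
Qed.

(** If m > 0 then g1 increases through 0, so g exceeds g 0 on the right of 0 when
    g1 0 >= 0, and on the left otherwise. *)
Lemma second_derivative_test (g g1 : R -> R) (m d : R) : (0 < d)%R ->
  (forall t, (Rabs t < d)%R -> is_derive g t (g1 t)) -> is_derive g1 0%R m ->
  (forall t, (Rabs t < d)%R -> (g t <= g 0)%R) -> (m <= 0)%R.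
Proof.
  intros Hd Hg Hg1 Hmax. apply Rnot_lt_le. intros Hm.
  apply is_derive_Reals in Hg1. destruct (Hg1 (m / 2)%R) as [e He]; [lra|].
  set (t := (Rmin d e / 2)%R).
  assert (Hmin : (0 < Rmin d e)%R) by (apply Rmin_pos; [exact Hd|apply cond_pos]).
  assert (Ht : (0 < t < d /\ t < e)%R).
  { pose proof (Rmin_l d e). pose proof (Rmin_r d e). unfold t. lra. }
  assert (Hsl : forall c, (c <> 0)%R -> (Rabs c < e)%R -> ((g1 c - g1 0) / c > 0)%R).
  { intros c Hc0 Hce. specialize (He c Hc0 Hce). rewrite Rplus_0_l in He.
    apply Rabs_lt_between in He. lra. }
  assert (Hmv : forall a b, (- d < a)%R -> (a < b)%R -> (b < d)%R ->
     exists c, (a < c < b)%R /\ (g b - g a = g1 c * (b - a))%R).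
  { intros a b Ha Hab Hb.
    destruct (MVT_cor2 g g1 a b Hab) as [c [Hc1 Hc2]].
    - intros c Hc. apply is_derive_Reals, Hg. apply Rabs_lt_between. lra.
    - exists c. auto. }
  destruct (Rle_dec 0 (g1 0)) as [H0|H0].
  - destruct (Hmv 0%R t) as [c [Hc1 Hc2]]; try lra.
    assert (Hs := Hsl c ltac:(lra) ltac:(rewrite Rabs_pos_eq; lra)).
    assert (g1 c - g1 0 > 0)%R.
    { replace (g1 c - g1 0)%R with ((g1 c - g1 0) / c * c)%R by (field; lra). nra. }
    specialize (Hmax t ltac:(rewrite Rabs_pos_eq; lra)). nra.
  - destruct (Hmv (- t)%R 0%R) as [c [Hc1 Hc2]]; try lra.
    assert (Hs := Hsl c ltac:(lra) ltac:(rewrite Rabs_left; lra)).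
    assert (g1 c - g1 0 < 0)%R.
    { replace (g1 c - g1 0)%R with ((g1 c - g1 0) / c * c)%R by (field; lra). nra. }
    specialize (Hmax (- t)%R ltac:(rewrite Rabs_left; lra)). nra.
Qed.

Definition sqmod (w : C) : R := (Re w ^ 2 + Im w ^ 2)%R.

Lemma sqmod_Cmod (w : C) : sqmod w = (Cmod w ^ 2)%R.
Proof. unfold sqmod. symmetry. apply Cmod2_alt. Qed.

(** A function whose gradient is given by a complex differentiable [kappa] is
    harmonic: the second derivatives in the directions 1 and i are the real parts
    of kappa' and of i^2 kappa', so they cancel. The term eta |z|^2 makes the
    Laplacian positive, which excludes local maxima. *)
Lemma no_local_max (psi : C -> R) (kappa : C -> C) (z0 kappa1 : C) (eta delta : R) :
  (0 < eta)%R -> (0 < delta)%R ->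
  (forall z d, (Cmod (z - z0) < delta)%R ->
     is_derive (fun t : R => psi (z + t * d)) 0%R (Re (kappa z * d))) ->
  cder kappa z0 kappa1 ->
  ~ (forall z, (Cmod (z - z0) < delta)%R ->
       (psi z + eta * sqmod z <= psi z0 + eta * sqmod z0)%R).
Proof.
  intros Heta Hdelta Hpsi Hk Hmax.
  assert (Hdir : forall d, Cmod d = 1%R -> (Re (kappa1 * (d * d)) + 2 * eta <= 0)%R).
  { intros d Hd.
    assert (Hd2 : (fst d * fst d + snd d * snd d = 1)%R).
    { pose proof (Cmod_sqr d) as E. unfold Re, Im in E. rewrite Hd in E. lra. }
    assert (Hnear : forall t : R, (Rabs t < delta)%R -> (Cmod (z0 + t * d - z0) < delta)%R).
    { intros t Ht. replace (z0 + t * d - z0) with (t * d) by ring.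
      rewrite Cmod_mult, Cmod_R, Hd. lra. }
    apply (second_derivative_test
      (fun t : R => psi (z0 + t * d)%C + eta * sqmod (z0 + t * d)%C)%R
      (fun t : R => Re (kappa (z0 + t * d)%C * d)
                + 2 * eta * (fst z0 * fst d + snd z0 * snd d + t))%R _ delta Hdelta).
    - intros t Ht. apply (is_derive_plus (V := R_NormedModule)).
      + specialize (Hpsi _ d (Hnear t Ht)).
        assert (Hs : is_derive (fun s : R => (s - t)%R) t 1%R)
          by (auto_derive; [exact I|ring]).
        replace 0%R with (t - t)%R in Hpsi by ring.
        pose proof (is_derive_comp _ (fun s => s - t)%R _ _ _ Hpsi Hs) as HH.
        replace (Re (kappa (z0 + t * d) * d))
          with (scal (V := R_NormedModule) 1%R (Re (kappa (z0 + t * d) * d)))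
          by (change (1 * Re (kappa (z0 + t * d)%C * d) = Re (kappa (z0 + t * d)%C * d))%R; ring).
        eapply is_derive_ext; [|exact HH]. intros s. simpl. f_equal.
        rewrite RtoC_minus. ring.
      + unfold sqmod, Re, Im. simpl. auto_derive; [exact I|].
        transitivity (2 * eta * (fst z0 * fst d + snd z0 * snd d
           + t * (fst d * fst d + snd d * snd d)))%R; [ring|rewrite Hd2; ring].
    - destruct (cder_line kappa z0 d kappa1 0) as [K1 K2].
      { now replace (z0 + 0%R * d) with z0 by ring. }
      apply (is_derive_plus (V := R_NormedModule)).
      + assert (K3 := is_derive_minus (V := R_NormedModule) _ _ _ _ _
          (is_derive_scal _ _ (fst d) _ K1) (is_derive_scal _ _ (snd d) _ K2)).
        evar_last; [eapply is_derive_ext; [|exact K3]|].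
        * intros t. unfold minus, plus, opp, Re, Im. simpl. ring.
        * unfold minus, plus, opp, Re, Im. simpl. ring.
      + auto_derive; [exact I|ring].
    - intros t Ht. replace (z0 + 0%R * d) with z0 by ring. apply Hmax, Hnear, Ht. }
  pose proof (Hdir 1 Cmod_1) as H1. pose proof (Hdir Ci Cmod_Ci) as H2.
  unfold Re in *. simpl in *. lra.
Qed.

Lemma is_derive_ln_sqmod (f : C -> C) (z l d : C) :
  cder f z l -> f z <> 0 ->
  is_derive (fun t : R => ln (sqmod (f (z + t * d)))) 0%R (Re (2 * (l / f z) * d)).
Proof.
  intros Hf Hz. destruct (Hf d) as [F1 F2].
  pose proof (sum_sqr_neq_0 _ Hz) as Hn.
  assert (Ez : z + 0%R * d = z) by ring.
  replace (2 * (l / f z) * d) with (2 * ((l * d) * / f z)) by (unfold Cdiv; ring).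
  unfold sqmod, Re, Im in *.
  set (x1 := fun t : R => fst (f (z + t * d))) in *.
  set (y1 := fun t : R => snd (f (z + t * d))) in *.
  assert (E1 : x1 0%R = fst (f z)) by (unfold x1; now rewrite Ez).
  assert (E2 : y1 0%R = snd (f z)) by (unfold y1; now rewrite Ez).
  change (is_derive (fun t => ln (x1 t ^ 2 + y1 t ^ 2)) 0%R
            (fst (2 * ((l * d) * / f z)))).
  derive_from_components.
  - rewrite E1, E2. simpl in Hn.
    assert (0 <= fst (f z) * fst (f z))%R by apply Rle_0_sqr.
    assert (0 <= snd (f z) * snd (f z))%R by apply Rle_0_sqr. lra.
  - rewrite E1, E2. simpl. simpl in Hn. field. intros Hc. apply Hn. lra.
Qed.

Lemma ball_Cmod (z w : C) (e : R) : ball z (e / 2)%R w -> (Cmod (w - z) < e)%R.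
Proof.
  intros [H1 H2]. eapply Rle_lt_trans; [apply Cmod_le_abs|].
  change (Rabs (fst w - fst z) < e / 2)%R in H1.
  change (Rabs (snd w - snd z) < e / 2)%R in H2.
  simpl. unfold Rminus in H1, H2. lra.
Qed.

Lemma ccont_continuous_Re (f : C -> C) (z : C) :
  ccont f z -> continuous (fun w => Re (f w)) z.
Proof.
  intros H P [e He]. destruct (H e (cond_pos e)) as [d [Hd Hw]].
  exists (mkposreal (d / 2) ltac:(lra)). intros w Hb. apply He.
  change (Rabs (Re (f w) - Re (f z)) < e)%R.
  eapply Rle_lt_trans; [|apply (Hw w (ball_Cmod _ _ _ Hb))].
  eapply Rle_trans; [|apply Rabs_Re_le]. right. f_equal.
Qed.

Lemma ccont_continuous_Im (f : C -> C) (z : C) :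
  ccont f z -> continuous (fun w => Im (f w)) z.
Proof.
  intros H P [e He]. destruct (H e (cond_pos e)) as [d [Hd Hw]].
  exists (mkposreal (d / 2) ltac:(lra)). intros w Hb. apply He.
  change (Rabs (Im (f w) - Im (f z)) < e)%R.
  eapply Rle_lt_trans; [|apply (Hw w (ball_Cmod _ _ _ Hb))].
  eapply Rle_trans; [|apply Rabs_Im_le]. right. f_equal.
Qed.

Lemma continuous_eps (g : C -> R) (z : C) : continuous g z ->
  forall eps, (0 < eps)%R -> exists d, (0 < d)%R /\
    forall w, (Cmod (w - z) < d)%R -> (Rabs (g w - g z) < eps)%R.
Proof.
  intros H eps Heps.
  assert (Hl : locally (g z) (fun y => Rabs (y - g z) < eps)%R).
  { exists (mkposreal eps Heps). intros y Hy. exact Hy. }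
  destruct (H _ Hl) as [d Hd]. exists d. split; [apply cond_pos|].
  intros w Hw. apply Hd. apply C_NormedModule_mixin_compat1. exact Hw.
Qed.

Lemma ccont_continuous_sqmod (f : C -> C) (z : C) :
  ccont f z -> continuous (fun w => sqmod (f w)) z.
Proof.
  intros H. pose proof (ccont_continuous_Re f z H) as H1.
  pose proof (ccont_continuous_Im f z H) as H2. unfold sqmod. simpl.
  apply (continuous_plus (V := R_NormedModule));
    apply (continuous_mult (K := R_AbsRing)); try assumption;
    apply (continuous_mult (K := R_AbsRing)); try assumption;
    apply continuous_const.
Qed.

Lemma ccont_id (z : C) : ccont (fun w => w) z.
Proof. intros eps Heps. exists eps. auto. Qed.

Lemma sqmod_pos (w : C) : w <> 0 -> (0 < sqmod w)%R.
Proof. intros H. rewrite sqmod_Cmod. apply pow_lt. now apply Cmod_gt_0. Qed.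

(** The Schwarz lemma. By contradiction: ln |omega/z|^2 is harmonic where omega
    does not vanish, and adding eta (ln |z| + |z|^2) makes it strictly subharmonic
    and makes it tend to -oo at the origin. A point at which the Schwarz bound fails
    then produces an interior maximum over an annulus. *)
Lemma schwarz_lemma (omega omega1 : C -> C) (r : R) :
  (forall z, (Cmod z < r)%R -> cder omega z (omega1 z)) ->
  (forall z, (Cmod z < r)%R -> exists l, cder omega1 z l) ->
  (forall z, (Cmod z < r)%R -> locally_bounded omega1 z) ->
  (forall z, (Cmod z < r)%R -> (Cmod (omega z) <= 1)%R) ->
  omega 0 = 0 ->
  forall z, (Cmod z < r)%R -> (r * Cmod (omega z) <= Cmod z)%R.
Proof.
  intros H1 H2 Hb Hle H0 z1 Hz1. apply Rnot_lt_le. intros Hbad.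
  assert (Hr : (0 < r)%R) by (pose proof (Cmod_ge_0 z1); lra).
  assert (Hball : forall z, (Cmod z < r)%R -> exists d, (0 < d)%R /\
    forall w, (Cmod (w - z) < d)%R -> (Cmod w < r)%R).
  { intros z Hz. exists (r - Cmod z)%R. split; [lra|]. intros w Hw.
    pose proof (Cmod_triangle (w - z) z) as Ht.
    replace (w - z + z) with w in Ht by ring. lra. }
  assert (Hcont : forall z, (Cmod z < r)%R -> ccont omega z).
  { intros z Hz. destruct (Hball z Hz) as [d [Hd Hw]].
    apply (cder_ccont omega omega1 z d Hd); auto. }
  assert (Hz1n : z1 <> 0).
  { intros E. subst z1. rewrite H0, Cmod_0, Rmult_0_r in Hbad. lra. }
  assert (Hm1 : (0 < Cmod z1)%R) by now apply Cmod_gt_0.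
  assert (Hw1p : (0 < Cmod (omega z1))%R) by nra.
  pose proof (Hle z1 Hz1) as Hw1.
  set (rho0 := (Cmod z1 / Cmod (omega z1))%R).
  assert (Hrho0 : (rho0 * Cmod (omega z1) = Cmod z1)%R) by (unfold rho0; field; lra).
  assert (Hrho1 : (rho0 < r)%R) by nra.
  assert (Hrho2 : (Cmod z1 <= rho0)%R).
  { rewrite <- Hrho0. rewrite <- (Rmult_1_r rho0) at 2.
    apply Rmult_le_compat_l; [|exact Hw1]. apply Rlt_le. unfold rho0.
    now apply Rdiv_lt_0_compat. }
  set (rho := ((rho0 + r) / 2)%R).
  assert (Hrho : (rho0 < rho < r)%R) by (unfold rho; lra).
  (* the logarithmic gap at z1, and the size of the perturbation that it allows *)
  set (g := (2 * (ln (Cmod (omega z1)) - ln (Cmod z1) + ln rho))%R).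
  assert (Hg : (0 < g)%R).
  { unfold g. assert (ln (Cmod z1) < ln rho + ln (Cmod (omega z1)))%R; [|lra].
    rewrite <- ln_mult by lra. apply ln_increasing; [exact Hm1|]. nra. }
  set (B := (ln rho - ln (Cmod z1) + rho ^ 2)%R).
  assert (HB : (0 < B)%R).
  { unfold B. assert (ln (Cmod z1) < ln rho)%R by (apply ln_increasing; lra). nra. }
  set (eta := (g / (B + 1))%R).
  assert (Heta : (0 < eta)%R) by (apply Rdiv_lt_0_compat; lra).
  assert (HetaB : (eta * B < g)%R).
  { unfold eta. apply Rmult_lt_reg_r with (B + 1)%R; [lra|].
    replace (g / (B + 1) * B * (B + 1))%R with (g * B)%R by (field; lra). nra. }
  set (W := fun z : C => (- (1 - eta / 2) * ln (sqmod z) + eta * sqmod z)%R).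
  set (Phi := fun z : C => (sqmod (omega z) * exp (W z))%R).
  assert (Hln : forall x : R, (0 < x)%R -> ln (x ^ 2) = (2 * ln x)%R).
  { intros x Hx. simpl. rewrite Rmult_1_r, ln_mult by assumption. ring. }
  assert (HPhi1 : Phi z1 = exp (2 * ln (Cmod (omega z1)) + W z1)).
  { unfold Phi. rewrite exp_plus. f_equal. rewrite <- Hln by exact Hw1p.
    rewrite exp_ln by now apply pow_lt. apply sqmod_Cmod. }
  assert (HW1 : (W z1 >= - (2 - eta) * ln (Cmod z1))%R).
  { unfold W. rewrite sqmod_Cmod, Hln by exact Hm1.
    assert (0 <= eta * Cmod z1 ^ 2)%R by (apply Rmult_le_pos; [lra|apply pow_le; lra]). lra. }
  destruct (Hball 0) as [d0 [Hd0 Hd0w]]; [now rewrite Cmod_0|].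
  destruct (cder_lipschitz omega omega1 0 d0 Hd0) as (K & dK & HK & HdK & HKw); auto.
  { apply Hb. now rewrite Cmod_0. }
  set (T := (2 * ln (Cmod (omega z1)) + W z1 - 2 * ln K - eta - 1)%R).
  set (eps := Rmin (Rmin (Cmod z1) (dK / 2)) (Rmin 1 (exp (T / eta)))).
  assert (Heps : (0 < eps)%R).
  { unfold eps. repeat apply Rmin_pos; try lra. apply exp_pos. }
  assert (Heps1 : (eps <= Cmod z1)%R)
    by (unfold eps; eapply Rle_trans; apply Rmin_l).
  assert (Heps2 : (eps < dK)%R).
  { apply Rle_lt_trans with (dK / 2)%R; [|lra].
    unfold eps; eapply Rle_trans; [apply Rmin_l|apply Rmin_r]. }
  assert (Heps3 : (eps <= 1)%R)
    by (unfold eps; eapply Rle_trans; [apply Rmin_r|apply Rmin_l]).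
  assert (Heps4 : (eta * ln eps <= T)%R).
  { assert (ln eps <= T / eta)%R.
    { rewrite <- (ln_exp (T / eta)). apply ln_le; [exact Heps|].
      unfold eps; eapply Rle_trans; apply Rmin_r. }
    apply Rle_trans with (eta * (T / eta))%R; [apply Rmult_le_compat_l; lra|].
    right. field. lra. }
  destruct (compact_max (fun z => eps <= Cmod z <= rho)%R Phi rho) as (zs & Hzs & Hmax).
  - intros z Hz. lra.
  - intros z Hz.
    destruct (Rlt_dec (Cmod z) eps) as [Hl|Hl].
    + exists (eps - Cmod z)%R. split; [lra|]. intros w Hw Hc.
      pose proof (Cmod_triangle (w - z) z) as Ht.
      replace (w - z + z) with w in Ht by ring. lra.
    + exists (Cmod z - rho)%R. split; [lra|]. intros w Hw Hc.
      pose proof (Cmod_triangle (z - w) w) as Ht.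
      replace (z - w + w) with z in Ht by ring.
      replace (z - w) with (- (w - z)) in Ht by ring. rewrite Cmod_opp in Ht. lra.
  - exists z1. lra.
  - intros z Hz e He.
    assert (Hzn : z <> 0) by (apply Cmod_gt_0; lra).
    assert (HPc : continuous Phi z).
    { unfold Phi. apply (continuous_mult (K := R_AbsRing)).
      - apply ccont_continuous_sqmod, Hcont. lra.
      - apply (continuous_comp W exp).
        + unfold W. apply (continuous_plus (V := R_NormedModule)).
          * apply (continuous_mult (K := R_AbsRing)); [apply continuous_const|].
            apply (continuous_comp sqmod ln).
            -- apply (ccont_continuous_sqmod (fun w => w)), ccont_id.
            -- apply (ex_derive_continuous ln). exists (/ sqmod z)%R.
               apply is_derive_ln. now apply sqmod_pos.
          * apply (continuous_mult (K := R_AbsRing)); [apply continuous_const|].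
            apply (ccont_continuous_sqmod (fun w => w)), ccont_id.
        + apply (ex_derive_continuous exp). exists (exp (W z)). apply is_derive_exp. }
    destruct (continuous_eps Phi z HPc e He) as [d [Hd Hw]].
    exists d. split; [exact Hd|]. intros w _ Hwd.
    specialize (Hw w Hwd). apply Rabs_lt_between in Hw. lra.
  - assert (Hge : (Phi z1 <= Phi zs)%R) by (apply Hmax; lra).
    assert (Hzsn : zs <> 0) by (apply Cmod_gt_0; lra).
    assert (Hosn : omega zs <> 0).
    { intros E. assert (Phi zs = 0)%R.
      { unfold Phi, sqmod. rewrite E. simpl. ring. }
      rewrite HPhi1 in Hge.
      pose proof (exp_pos (2 * ln (Cmod (omega z1)) + W z1)). lra. }
    assert (Hop : (0 < Cmod (omega zs))%R) by now apply Cmod_gt_0.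
    assert (HPhis : Phi zs = exp (2 * ln (Cmod (omega zs)) + W zs)).
    { unfold Phi. rewrite exp_plus. f_equal. rewrite <- Hln by exact Hop.
      rewrite exp_ln by now apply pow_lt. apply sqmod_Cmod. }
    assert (Hge2 : (2 * ln (Cmod (omega z1)) + W z1 <= 2 * ln (Cmod (omega zs)) + W zs)%R).
    { rewrite HPhi1, HPhis in Hge. apply Rnot_lt_le. intros Hlt.
      apply exp_increasing in Hlt. lra. }
    assert (HWs : W zs = (- (2 - eta) * ln (Cmod zs) + eta * Cmod zs ^ 2)%R).
    { unfold W. rewrite sqmod_Cmod, Hln by lra. field. }
    (* the maximum is not on the outer circle, where |omega| <= 1 *)
    assert (Hout : (Cmod zs < rho)%R).
    { apply Rnot_le_lt. intros Hc. assert (Ec : Cmod zs = rho) by lra.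
      rewrite Ec in HWs.
      assert (ln (Cmod (omega zs)) <= 0)%R.
      { rewrite <- ln_1. apply ln_le; [exact Hop|]. apply Hle. lra. }
      unfold B in HetaB. unfold g in HetaB. nra. }
    (* nor on the inner one, where |omega| <= K |z| *)
    assert (Hin : (eps < Cmod zs)%R).
    { apply Rnot_le_lt. intros Hc. assert (Ec : Cmod zs = eps) by lra.
      specialize (HKw zs). rewrite H0 in HKw.
      replace (zs - 0) with zs in HKw by ring.
      replace (omega zs - 0) with (omega zs) in HKw by ring.
      specialize (HKw ltac:(lra)). rewrite Ec in HKw, HWs.
      assert (ln (Cmod (omega zs)) <= ln K + ln eps)%R.
      { rewrite <- ln_mult by lra. apply ln_le; [exact Hop|exact HKw]. }
      assert (eta * eps ^ 2 <= eta)%R.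
      { rewrite <- (Rmult_1_r eta) at 2. apply Rmult_le_compat_l; [lra|]. nra. }
      unfold T in Heps4. lra. }
    destruct (cder_ccont omega omega1 zs (r - Cmod zs)) with (eps := Cmod (omega zs))
      as [dn [Hdn Hnz]]; [lra| |apply Hb; lra|exact Hop|].
    { intros w Hw. apply H1. pose proof (Cmod_triangle (w - zs) zs) as Ht.
      replace (w - zs + zs) with w in Ht by ring. lra. }
    assert (Hnz2 : forall w, (Cmod (w - zs) < dn)%R -> omega w <> 0).
    { intros w Hw E. specialize (Hnz w Hw). rewrite E in Hnz.
      replace (0 - omega zs) with (- omega zs) in Hnz by ring.
      rewrite Cmod_opp in Hnz. lra. }
    set (dl := Rmin dn (Rmin (rho - Cmod zs) (Cmod zs - eps))).
    assert (Hdl : (0 < dl)%R) by (unfold dl; repeat apply Rmin_pos; lra).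
    assert (Hdl1 : (dl <= dn)%R) by apply Rmin_l.
    assert (Hdl2 : (dl <= rho - Cmod zs)%R)
      by (unfold dl; eapply Rle_trans; [apply Rmin_r|apply Rmin_l]).
    assert (Hdl3 : (dl <= Cmod zs - eps)%R)
      by (unfold dl; eapply Rle_trans; [apply Rmin_r|apply Rmin_r]).
    assert (Hann : forall w, (Cmod (w - zs) < dl)%R -> (eps <= Cmod w <= rho)%R).
    { intros w Hw. pose proof (Cmod_triangle (w - zs) zs) as Ht.
      replace (w - zs + zs) with w in Ht by ring.
      pose proof (Cmod_triangle (zs - w) w) as Ht2.
      replace (zs - w + w) with zs in Ht2 by ring.
      replace (zs - w) with (- (w - zs)) in Ht2 by ring. rewrite Cmod_opp in Ht2. lra. }
    destruct (H2 zs) as [l2 Hl2]; [lra|].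
    pose (kappa := fun z => 2 * (omega1 z * / omega z) + (- (2 - eta))%R * / z).
    assert (Hkappa : exists k1, cder kappa zs k1).
    { eexists. unfold kappa. apply cder_plus.
      - apply cder_mult; [apply cder_const|]. apply cder_mult; [exact Hl2|].
        apply cder_inv; [apply H1; lra|exact Hosn].
      - apply cder_mult; [apply cder_const|]. apply cder_inv; [apply cder_id|exact Hzsn]. }
    destruct Hkappa as [k1 Hk1].
    apply (no_local_max
      (fun z => ln (sqmod (omega z)) + (- (1 - eta / 2)) * ln (sqmod z))%R
      kappa zs k1 eta dl Heta Hdl); [|exact Hk1|].
    + intros z d Hz.
      assert (Hzn : z <> 0) by (apply Cmod_gt_0; pose proof (Hann z Hz); lra).
      assert (Hzr : (Cmod z < r)%R) by (pose proof (Hann z Hz); lra).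
      assert (Hozn : omega z <> 0) by (apply Hnz2; lra).
      pose proof (is_derive_ln_sqmod omega z _ d (H1 z Hzr) Hozn) as D1.
      pose proof (is_derive_ln_sqmod (fun w => w) z 1 d (cder_id z) Hzn) as D2.
      evar_last.
      * apply (is_derive_plus (V := R_NormedModule) _ _ _ _ _ D1
                 (is_derive_scal _ _ (- (1 - eta / 2))%R _ D2)).
      * unfold kappa, Cdiv.
        replace (Re ((2 * (omega1 z * / omega z) + (- (2 - eta))%R * / z) * d))
          with (Re (2 * (omega1 z * / omega z) * d)
                + (- (1 - eta / 2)) * Re (2 * (1 * / z) * d))%R; [reflexivity|].
        unfold Re. simpl. field.
        apply sum_sqr_neq_0 in Hzn. apply sum_sqr_neq_0 in Hozn. simpl in *.
        split; intros Hc; [apply Hzn|apply Hozn]; lra.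
    + intros w Hw.
      assert (Hwl : (Phi w <= Phi zs)%R) by (apply Hmax, Hann, Hw).
      assert (Hown : omega w <> 0) by (apply Hnz2; lra).
      assert (EP : forall z, omega z <> 0 ->
        (ln (Phi z) = ln (sqmod (omega z)) + (- (1 - eta / 2)) * ln (sqmod z)
           + eta * sqmod z)%R).
      { intros z Hz. unfold Phi. rewrite ln_mult, ln_exp.
        - unfold W. ring.
        - now apply sqmod_pos.
        - apply exp_pos. }
      rewrite <- !EP by assumption. apply ln_le; [|exact Hwl].
      unfold Phi. apply Rmult_lt_0_compat; [now apply sqmod_pos|apply exp_pos].
Qed.

(** * Functions with values in a sector *)

Definition sector (beta : R) (w : C) : Prop :=
  (Rabs (Im w) * cos beta < Re w * sin beta)%R.

Lemma sin_Rabs (v : R) : (- PI <= v <= PI)%R -> Rabs (sin v) = sin (Rabs v).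
Proof.
  intros Hv. destruct (Rle_dec 0 v) as [H|H].
  - rewrite (Rabs_pos_eq v H), Rabs_pos_eq; [reflexivity|]. apply sin_ge_0; lra.
  - rewrite (Rabs_left v) by lra. rewrite <- Rabs_Ropp, <- sin_neg, Rabs_pos_eq;
      [reflexivity|]. apply sin_ge_0; lra.
Qed.

Lemma cos_Rabs (v : R) : cos (Rabs v) = cos v.
Proof.
  unfold Rabs. destruct (Rcase_abs v); [apply cos_neg|reflexivity].
Qed.

(** In polar form, |Im w| cos beta - Re w sin beta = |w| sin (|arg w| - beta). *)
Lemma abs_arg_lt_sector (beta : R) (w : C) :
  (0 < beta < PI / 2)%R -> abs_arg_lt w beta <-> sector beta w.
Proof.
  intros Hbeta. unfold sector.
  pose proof PI_RGT_0 as HPI.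
  assert (Hpolar : w <> 0 ->
    (Rabs (Im w) * cos beta - Re w * sin beta
      = Cmod w * sin (Rabs (Carg w) - beta))%R /\ (Rabs (Carg w) <= PI)%R).
  { intros Hw. destruct (Carg_spec w Hw) as [E Hv].
    assert (Habs : (Rabs (Carg w) <= PI)%R) by (apply Rabs_le; lra).
    split; [|exact Habs].
    assert (E1 : Re w = (Cmod w * cos (Carg w))%R)
      by (rewrite E at 1; unfold expi, Re; simpl; ring).
    assert (E2 : Im w = (Cmod w * sin (Carg w))%R)
      by (rewrite E at 1; unfold expi, Im; simpl; ring).
    rewrite E1, E2, Rabs_mult, (Rabs_pos_eq (Cmod w)) by apply Cmod_ge_0.
    rewrite sin_Rabs by lra. rewrite sin_minus, cos_Rabs. ring. }
  split.
  - intros [Hw Hv]. destruct (Hpolar Hw) as [E _].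
    assert (Hs : (sin (Rabs (Carg w) - beta) < 0)%R).
    { apply sin_lt_0_var; pose proof (Rabs_pos (Carg w)); lra. }
    apply Cmod_gt_0 in Hw. nra.
  - intros H.
    assert (Hw : w <> 0).
    { intros E. rewrite E in H. simpl in H. rewrite Rabs_R0 in H. lra. }
    split; [exact Hw|]. destruct (Hpolar Hw) as [E Hle].
    apply Rnot_le_lt. intros Hge.
    assert (0 <= sin (Rabs (Carg w) - beta))%R by (apply sin_ge_0; lra).
    pose proof (Cmod_ge_0 w). nra.
Qed.

Lemma cos_sin_pos (beta : R) : (0 < beta < PI / 2)%R -> (0 < cos beta)%R /\ (0 < sin beta)%R.
Proof. intros H. split; [apply cos_gt_0; lra|apply sin_gt_0; lra]. Qed.

Lemma sector_Re_pos (beta : R) (w : C) :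
  (0 < beta < PI / 2)%R -> sector beta w -> (0 < Re w)%R.
Proof.
  intros Hbeta H. unfold sector in H. destruct (cos_sin_pos beta Hbeta) as [Hc Hs].
  pose proof (Rabs_pos (Im w)). apply Rnot_le_lt. intros Hn. nra.
Qed.

Lemma half_angle (alpha : R) : (0 < alpha < 1)%R -> (0 < PI * alpha / 2 < PI / 2)%R.
Proof. pose proof PI_RGT_0 as HPI. intros Ha. split; nra. Qed.

Lemma Cmod_rpow (k : R) (w : C) : w <> 0 -> Cmod (rpow k w) = exp (k * ln (Cmod w)).
Proof.
  intros Hw. apply Cmod_gt_0 in Hw.
  assert (E : (k * ln (Re w ^ 2 + Im w ^ 2) / 2 = k * ln (Cmod w))%R).
  { rewrite <- Cmod2_alt. simpl. rewrite Rmult_1_r, ln_mult by assumption. field. }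
  unfold rpow. rewrite E. set (x := exp (k * ln (Cmod w))).
  set (y := (k * atan (Im w / Re w))%R).
  assert (Hx : (0 < x)%R) by apply exp_pos.
  replace ((x * cos y, x * sin y)%R) with (x * (cos y, sin y))
    by (apply injective_projections; simpl; ring).
  rewrite Cmod_mult, Cmod_R, Rabs_pos_eq by lra.
  assert (E1 : Cmod (cos y, sin y) = 1%R).
  { unfold Cmod. simpl.
    replace (cos y * (cos y * 1) + sin y * (sin y * 1))%R with 1%R; [apply sqrt_1|].
    pose proof (sin2_cos2 y) as Hsc. unfold Rsqr in Hsc. lra. }
  rewrite E1. ring.
Qed.

Lemma rpow_1 (k : R) : rpow k 1 = 1.
Proof.
  unfold rpow. simpl.
  replace (1 * (1 * 1) + 0 * (0 * 1))%R with 1%R by ring.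
  replace (0 / 1)%R with 0%R by field.
  rewrite ln_1, atan_0, Rmult_0_r. replace (0 / 2)%R with 0%R by field.
  rewrite exp_0, cos_0, sin_0. apply injective_projections; simpl; ring.
Qed.

Lemma rpow_sector_Re_pos (alpha : R) (w : C) : (0 < alpha < 1)%R ->
  sector (PI * alpha / 2) w -> (0 < Re (rpow (/ alpha) w))%R.
Proof.
  intros Ha Hw. pose proof (half_angle alpha Ha) as Hbeta.
  pose proof (sector_Re_pos _ w Hbeta Hw) as Hre.
  destruct (cos_sin_pos _ Hbeta) as [Hc Hs]. unfold sector in Hw.
  set (beta := (PI * alpha / 2)%R) in *.
  unfold rpow. simpl. apply Rmult_lt_0_compat; [apply exp_pos|].
  set (v := atan (Im w / Re w)).
  assert (Hq : (Rabs (Im w / Re w) < tan beta)%R).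
  { unfold Rdiv. rewrite Rabs_mult, Rabs_inv, (Rabs_pos_eq (Re w)) by lra.
    unfold tan. apply Rmult_lt_reg_r with (Re w * cos beta)%R;
      [now apply Rmult_lt_0_compat|].
    replace (Rabs (Im w) * / Re w * (Re w * cos beta))%R
      with (Rabs (Im w) * cos beta)%R by (field; lra).
    replace (sin beta / cos beta * (Re w * cos beta))%R
      with (Re w * sin beta)%R by (field; lra). exact Hw. }
  apply Rabs_lt_between in Hq.
  assert (Hv : (- beta < v < beta)%R).
  { unfold v. rewrite <- (atan_tan beta) by (unfold beta in *; lra).
    rewrite <- atan_opp. split; apply atan_increasing; lra. }
  assert (Eb : (/ alpha * beta = PI / 2)%R) by (unfold beta; field; lra).
  assert (Hk : (0 < / alpha)%R) by (apply Rinv_0_lt_compat; lra).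
  apply cos_gt_0; nra.
Qed.

Lemma rpow_sector_side (alpha x eps : R) : (0 < alpha < 1)%R -> (0 < x)%R ->
  eps = 1%R \/ eps = (-1)%R ->
  rpow (/ alpha) (x * expi (eps * (PI * alpha / 2)))
  = (0%R, (eps * exp (/ alpha * ln x))%R).
Proof.
  intros Ha Hx He. pose proof (half_angle alpha Ha) as Hbeta.
  destruct (cos_sin_pos _ Hbeta) as [Hc Hs].
  set (beta := (PI * alpha / 2)%R) in *.
  assert (Eb : (/ alpha * beta = PI / 2)%R) by (unfold beta; field; lra).
  set (w := x * expi (eps * beta)).
  assert (E1 : Re w = (x * cos beta)%R /\ Im w = (x * (eps * sin beta))%R).
  { unfold w, expi, Re, Im. simpl. destruct He as [-> | ->].
    - rewrite Rmult_1_l. split; ring.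
    - replace (-1 * beta)%R with (- beta)%R by ring. rewrite cos_neg, sin_neg.
      split; ring. }
  destruct E1 as [E1 E2]. unfold rpow. rewrite E1, E2.
  replace ((x * cos beta) ^ 2 + (x * (eps * sin beta)) ^ 2)%R with (x * x)%R.
  2:{ pose proof (sin2_cos2 beta) as Hsc. unfold Rsqr in Hsc.
      transitivity (x * x * (sin beta * sin beta + cos beta * cos beta))%R;
        [rewrite Hsc; ring|]. destruct He as [-> | ->]; ring. }
  rewrite ln_mult by assumption.
  replace (x * (eps * sin beta) / (x * cos beta))%R with (eps * tan beta)%R
    by (unfold tan; field; lra).
  assert (Eat : atan (eps * tan beta) = (eps * beta)%R).
  { destruct He as [-> | ->].
    - rewrite !Rmult_1_l. apply atan_tan. lra.
    - replace (-1 * tan beta)%R with (- tan beta)%R by ring.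
      rewrite atan_opp, atan_tan by lra. ring. }
  rewrite Eat. replace (/ alpha * (eps * beta))%R with (eps * (PI / 2))%R by (rewrite <- Eb; ring).
  replace (/ alpha * (ln x + ln x) / 2)%R with (/ alpha * ln x)%R by (field; lra).
  destruct He as [-> | ->].
  - rewrite !Rmult_1_l, cos_PI2, sin_PI2. apply injective_projections; simpl; ring.
  - replace (-1 * (PI / 2))%R with (- (PI / 2))%R by ring.
    rewrite cos_neg, sin_neg, cos_PI2, sin_PI2.
    apply injective_projections; simpl; ring.
Qed.

Record sector_valued (alpha r : R) (q q1 : C -> C) : Prop := {
  sv_cder : forall z, (Cmod z < r)%R -> cder q z (q1 z);
  sv_cder2 : forall z, (Cmod z < r)%R -> exists l, cder q1 z l;
  sv_bounded : forall z, (Cmod z < r)%R -> locally_bounded q1 z;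
  sv_sector : forall z, (Cmod z < r)%R -> sector (PI * alpha / 2) (q z);
  sv_one : q 0 = 1 }.

Lemma one_le_Cmod_plus_1 (u : C) : (0 < Re u)%R ->
  (1 <= Cmod (u + 1))%R /\ (Cmod u <= Cmod (u + 1))%R.
Proof.
  intros H. split.
  - eapply Rle_trans; [|apply Rabs_Re_le]. eapply Rle_trans; [|apply Rle_abs].
    unfold Re in *. simpl. lra.
  - apply Rsqr_incr_0_var; [|apply Cmod_ge_0]. unfold Rsqr.
    rewrite !Cmod_sqr. unfold Re, Im in *. simpl. nra.
Qed.

(** The Schwarz lemma for (u-1)/(u+1), where u is the (1/alpha)-th power of q, which
    has values in the right half-plane; |u-1|^2 = |u+1|^2 - 4 Re u. *)
Lemma sector_schwarz (alpha r : R) (q q1 : C -> C) (z : C) :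
  (0 < alpha < 1)%R -> sector_valued alpha r q q1 -> (Cmod z < r)%R ->
  let u := rpow (/ alpha) (q z) in
  ((r ^ 2 - Cmod z ^ 2) * sqmod (u + 1)%C <= 4 * r ^ 2 * Re u)%R.
Proof.
  intros Ha [Hq Hq2 Hb Hs Hone] Hz.
  pose proof (half_angle alpha Ha) as Hbeta.
  set (k := (/ alpha)%R).
  assert (Hk : (0 < k)%R) by (apply Rinv_0_lt_compat; lra).
  pose (U := fun z => rpow k (q z)).
  assert (HRe : forall z, (Cmod z < r)%R -> (0 < Re (q z))%R).
  { intros w Hw. apply (sector_Re_pos _ _ Hbeta), Hs, Hw. }
  assert (Hqn : forall z, (Cmod z < r)%R -> q z <> 0).
  { intros w Hw E. specialize (HRe w Hw). rewrite E in HRe. simpl in HRe. lra. }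
  assert (HU : forall z, (Cmod z < r)%R -> (0 < Re (U z))%R).
  { intros w Hw. now apply rpow_sector_Re_pos, Hs. }
  assert (HUn : forall z, (Cmod z < r)%R -> U z + 1 <> 0).
  { intros w Hw. apply Cmod_gt_0. pose proof (one_le_Cmod_plus_1 _ (HU w Hw)). lra. }
  pose (U1 := fun z => k * U z * q1 z / q z).
  assert (HUd : forall z, (Cmod z < r)%R -> cder U z (U1 z)).
  { intros w Hw. apply cder_rpow; auto. }
  pose (omega := fun z => 1 + (-2) * / (U z + 1)).
  pose (omega1 := fun z => 2 * (U1 z * (/ (U z + 1) * / (U z + 1)))).
  assert (Hom : forall w, (Cmod w < r)%R -> omega w * (U w + 1) = U w - 1).
  { intros w Hw. unfold omega. specialize (HUn w Hw). field. exact HUn. }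
  assert (Hsq : forall w, (Cmod w < r)%R ->
     (Cmod (omega w) ^ 2 * sqmod (U w + 1)%C = sqmod (U w + 1)%C - 4 * Re (U w))%R).
  { intros w Hw. rewrite (sqmod_Cmod (U w + 1)) at 1.
    rewrite <- Rpow_mult_distr, <- Cmod_mult, Hom, <- sqmod_Cmod by exact Hw.
    unfold sqmod, Re, Im. simpl. ring. }
  assert (Hpos : forall w, (Cmod w < r)%R -> (0 < sqmod (U w + 1)%C)%R).
  { intros w Hw. apply sqmod_pos. auto. }
  assert (Hsch : (r * Cmod (omega z) <= Cmod z)%R).
  { apply (schwarz_lemma omega omega1 r); [| | | | |exact Hz].
    - intros w Hw. unfold omega1.
      replace (2 * (U1 w * (/ (U w + 1) * / (U w + 1))))
        with (0 + (0 * / (U w + 1) + (-2) * (- (U1 w + 0) / ((U w + 1) * (U w + 1)))))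
        by (specialize (HUn w Hw); field; exact HUn).
      apply (cder_plus (fun _ => 1)); [apply cder_const|].
      apply (cder_mult (fun _ => -2) (fun w => / (U w + 1))); [apply cder_const|].
      apply (cder_inv (fun w => U w + 1)); [|auto].
      apply (cder_plus U (fun _ => 1)); [auto|apply cder_const].
    - intros w Hw. destruct (Hq2 w Hw) as [l Hl].
      assert (HI : cder (fun w => / (U w + 1)) w
                     (- (U1 w + 0) / ((U w + 1) * (U w + 1)))).
      { apply (cder_inv (fun w => U w + 1)); [|auto].
        apply (cder_plus U (fun _ => 1)); [auto|apply cder_const]. }
      eexists. unfold omega1, U1, Cdiv.
      apply cder_mult; [apply cder_const|]. apply cder_mult.
      + apply cder_mult; [apply cder_mult; [apply cder_mult;
          [apply cder_const|apply HUd; auto]|exact Hl]|].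
        apply cder_inv; [apply Hq; auto|auto].
      + apply cder_mult; exact HI.
    - intros w Hw. destruct (Hb w Hw) as (K & d & Hd & HK).
      assert (Hrw : (0 < r - Cmod w)%R) by lra.
      assert (Hin : forall v, (Cmod (v - w) < r - Cmod w)%R -> (Cmod v < r)%R).
      { intros v Hv. pose proof (Cmod_triangle (v - w) w) as Ht.
        replace (v - w + w) with v in Ht by ring. lra. }
      assert (Hqp : (0 < Cmod (q w))%R) by now apply Cmod_gt_0, Hqn.
      destruct (cder_ccont q q1 w (r - Cmod w) Hrw) with (eps := (Cmod (q w) / 2)%R)
        as [dq [Hdq Hqw]]; auto; [lra|].
      exists (2 * k * Rabs K / (Cmod (q w) / 2))%R, (Rmin (Rmin d dq) (r - Cmod w)).
      split; [repeat apply Rmin_pos; lra|].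
      intros v Hv.
      assert (Hv1 : (Cmod (v - w) < d)%R)
        by (eapply Rlt_le_trans; [exact Hv|eapply Rle_trans; apply Rmin_l]).
      assert (Hv2 : (Cmod (v - w) < dq)%R)
        by (eapply Rlt_le_trans; [exact Hv|eapply Rle_trans; [apply Rmin_l|apply Rmin_r]]).
      assert (Hv3 : (Cmod (v - w) < r - Cmod w)%R)
        by (eapply Rlt_le_trans; [exact Hv|apply Rmin_r]).
      specialize (Hin v Hv3). specialize (Hqw v Hv2). specialize (HK v Hv1).
      assert (Hqv : (Cmod (q w) / 2 <= Cmod (q v))%R).
      { pose proof (Cmod_triangle (q w - q v) (q v)) as Ht.
        replace (q w - q v + q v) with (q w) in Ht by ring.
        replace (q w - q v) with (- (q v - q w)) in Ht by ring.
        rewrite Cmod_opp in Ht. lra. }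
      destruct (one_le_Cmod_plus_1 (U v) (HU v Hin)) as [HU1 HU2].
      unfold omega1, U1. unfold Cdiv. rewrite !Cmod_mult, !Cmod_inv by auto.
      rewrite !Cmod_R, (Rabs_pos_eq 2), (Rabs_pos_eq k) by lra.
      set (a := Cmod (U v)) in *. set (b := Cmod (U v + 1)) in *.
      assert (Hab : (a * (/ b * / b) <= 1)%R).
      { apply Rle_trans with (b * (/ b * / b))%R.
        - apply Rmult_le_compat_r; [|exact HU2].
          apply Rmult_le_pos; apply Rlt_le, Rinv_0_lt_compat; lra.
        - replace (b * (/ b * / b))%R with (/ b)%R by (field; lra).
          rewrite <- Rinv_1. apply Rinv_le_contravar; lra. }
      assert (Hab0 : (0 <= a * (/ b * / b))%R).
      { apply Rmult_le_pos; [apply Cmod_ge_0|].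
        apply Rmult_le_pos; apply Rlt_le, Rinv_0_lt_compat; lra. }
      replace (2 * (k * a * Cmod (q1 v) * / Cmod (q v) * (/ b * / b)))%R
        with ((2 * k * Cmod (q1 v) * / Cmod (q v)) * (a * (/ b * / b)))%R by ring.
      rewrite <- (Rmult_1_r (2 * k * Rabs K / (Cmod (q w) / 2))).
      pose proof (Cmod_ge_0 (q1 v)) as Hq1p. pose proof (Rle_abs K).
      assert (Hqi : (0 < / Cmod (q v))%R) by (apply Rinv_0_lt_compat; lra).
      apply Rmult_le_compat; [|exact Hab0| |exact Hab].
      + apply Rmult_le_pos; [|lra]. apply Rmult_le_pos; lra.
      + unfold Rdiv at 1. apply Rmult_le_compat; [|lra| |].
        * apply Rmult_le_pos; lra.
        * apply Rmult_le_compat_l; lra.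
        * apply Rinv_le_contravar; lra.
    - intros w Hw. specialize (Hsq w Hw). specialize (Hpos w Hw). specialize (HU w Hw).
      pose proof (Cmod_ge_0 (omega w)). apply Rnot_lt_le. intros Hn.
      assert (Hn2 : (1 * sqmod (U w + 1)%C < Cmod (omega w) ^ 2 * sqmod (U w + 1)%C)%R)
        by (apply Rmult_lt_compat_r; [exact Hpos|nra]).
      lra.
    - unfold omega, U. rewrite Hone, rpow_1. field. }
  specialize (Hsq z Hz). specialize (Hpos z Hz).
  pose proof (Cmod_ge_0 (omega z)) as Hop. pose proof (Cmod_ge_0 z) as Hzp.
  assert (Hsqle : ((r * Cmod (omega z)) ^ 2 <= Cmod z ^ 2)%R).
  { apply pow_incr. split; [apply Rmult_le_pos; lra|exact Hsch]. }
  fold (U z). cbv zeta.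
  assert (r ^ 2 * (Cmod (omega z) ^ 2 * sqmod (U z + 1)%C) <= Cmod z ^ 2 * sqmod (U z + 1)%C)%R.
  { rewrite <- Rmult_assoc, <- Rpow_mult_distr. apply Rmult_le_compat_r; lra. }
  rewrite Hsq in H. lra.
Qed.

(** * First contact with the boundary of the sector *)

Lemma derive_linear_bound (g : R -> R) (m : R) : is_derive g 0%R m ->
  exists d, (0 < d)%R /\
    forall t, (0 < t < d)%R -> (Rabs (g t - g 0 - m * t) <= t)%R.
Proof.
  intros H. apply is_derive_Reals in H. destruct (H 1%R Rlt_0_1) as [d Hd].
  exists d. split; [apply cond_pos|]. intros t Ht.
  specialize (Hd t ltac:(lra) ltac:(rewrite Rabs_pos_eq; lra)).
  rewrite Rplus_0_l in Hd.
  replace (g t - g 0 - m * t)%R with (((g t - g 0) / t - m) * t)%R by (field; lra).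
  rewrite Rabs_mult, (Rabs_pos_eq t) by lra.
  apply Rle_trans with (1 * t)%R; [|lra]. apply Rmult_le_compat_r; lra.
Qed.

Lemma derive_nonpos_right (g : R -> R) (m d : R) : is_derive g 0%R m -> (0 < d)%R ->
  g 0%R = 0%R -> (forall t, (0 < t < d)%R -> (g t <= 0)%R) -> (m <= 0)%R.
Proof.
  intros H Hd0 H0 Hle. apply Rnot_lt_le. intros Hm.
  apply is_derive_Reals in H. destruct (H m Hm) as [e He].
  pose proof (cond_pos e) as Hep.
  set (t := (Rmin d e / 2)%R).
  assert (Ht : (0 < t < d /\ t < e)%R).
  { pose proof (Rmin_l d e). pose proof (Rmin_r d e).
    assert (0 < Rmin d e)%R by (apply Rmin_pos; lra). unfold t. lra. }
  specialize (He t ltac:(lra) ltac:(rewrite Rabs_pos_eq; lra)).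
  rewrite Rplus_0_l, H0, Rminus_0_r in He. apply Rabs_lt_between in He.
  specialize (Hle t ltac:(lra)).
  assert (g t / t <= 0)%R; [|lra].
  unfold Rdiv. assert (0 < / t)%R by (apply Rinv_0_lt_compat; lra). nra.
Qed.

Lemma Cmod_radial (z : C) (t : R) : (0 <= t <= 1)%R ->
  Cmod (z + t * (- z)) = ((1 - t) * Cmod z)%R.
Proof.
  intros Ht. replace (z + t * (- z)) with ((1 - t)%R * z) by (rewrite RtoC_minus; ring).
  rewrite Cmod_mult, Cmod_R, Rabs_pos_eq by lra. reflexivity.
Qed.

Lemma sector_schwarz_radial (alpha : R) (q q1 : C -> C) (z : C) (t : R) :
  (0 < alpha < 1)%R -> z <> 0 -> sector_valued alpha (Cmod z) q q1 -> (0 < t < 1)%R ->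
  let u := rpow (/ alpha) (q (z + t * (- z))) in
  ((1 - (1 - t) ^ 2) * sqmod (u + 1)%C <= 4 * Re u)%R.
Proof.
  intros Ha Hz Hsv Ht u. apply Cmod_gt_0 in Hz.
  assert (Hr : (Cmod (z + t * (- z)) < Cmod z)%R) by (rewrite Cmod_radial; nra).
  pose proof (sector_schwarz alpha (Cmod z) q q1 _ Ha Hsv Hr) as H.
  cbv zeta in H. fold u in H. rewrite Cmod_radial in H by lra.
  assert (Hz2 : (0 < Cmod z ^ 2)%R) by now apply pow_lt.
  apply Rmult_le_reg_l with (Cmod z ^ 2)%R; [exact Hz2|].
  rewrite Rpow_mult_distr in H. lra.
Qed.

(** On the radius that ends at z, the Schwarz lemma gives |q| >= (t/4)^alpha at
    distance t|z| from z. Since alpha < 1, this is not O(t), whereas a zero of q at z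
    would give |q| = O(t). *)
Lemma boundary_neq_0 (alpha : R) (q q1 : C -> C) (z l : C) :
  (0 < alpha < 1)%R -> z <> 0 -> sector_valued alpha (Cmod z) q q1 ->
  cder q z l -> q z <> 0.
Proof.
  intros Ha Hz Hsv Hl E0. pose proof (half_angle alpha Ha) as Hbeta.
  pose proof Hz as Hzp. apply Cmod_gt_0 in Hzp.
  destruct (Hl (- z)) as [D1 D2].
  destruct (derive_linear_bound _ _ D1) as [d1 [Hd1 B1]].
  destruct (derive_linear_bound _ _ D2) as [d2 [Hd2 B2]].
  set (m1 := Re (l * - z)) in *. set (m2 := Im (l * - z)) in *.
  replace (z + 0%R * - z) with z in B1, B2 by ring.
  rewrite E0 in B1, B2.
  set (K := (Rabs m1 + Rabs m2 + 2)%R).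
  assert (HK : (0 < K)%R).
  { unfold K. pose proof (Rabs_pos m1). pose proof (Rabs_pos m2). lra. }
  set (T := (alpha * ln 4 + ln K)%R).
  set (t := Rmin (Rmin (d1 / 2) (d2 / 2)) (Rmin (/ 2) (exp (- (T + 1) / (1 - alpha))))).
  assert (Ht : (0 < t)%R) by (unfold t; repeat apply Rmin_pos; try lra; apply exp_pos).
  assert (Ht1 : (t <= d1 / 2)%R) by (unfold t; eapply Rle_trans; apply Rmin_l).
  assert (Ht2 : (t <= d2 / 2)%R)
    by (unfold t; eapply Rle_trans; [apply Rmin_l|apply Rmin_r]).
  assert (Ht3 : (t <= / 2)%R)
    by (unfold t; eapply Rle_trans; [apply Rmin_r|apply Rmin_l]).
  assert (Ht4 : (ln t <= - (T + 1) / (1 - alpha))%R).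
  { rewrite <- (ln_exp (- (T + 1) / (1 - alpha))). apply ln_le; [exact Ht|].
    unfold t; eapply Rle_trans; apply Rmin_r. }
  specialize (B1 t ltac:(lra)). specialize (B2 t ltac:(lra)).
  set (w := q (z + t * - z)) in *.
  assert (Hws : sector (PI * alpha / 2) w).
  { apply (sv_sector _ _ _ _ Hsv). rewrite Cmod_radial; nra. }
  pose proof (sector_Re_pos _ _ Hbeta Hws) as HwRe.
  assert (Hw0 : w <> 0) by (intros E; rewrite E in HwRe; simpl in HwRe; lra).
  assert (HwK : (Cmod w <= K * t)%R).
  { eapply Rle_trans; [apply Cmod_le_abs|].
    assert (A : forall y m, (Rabs (y - 0 - m * t) <= t)%R -> (Rabs y <= (Rabs m + 1) * t)%R).
    { intros y m Hy. replace y with ((y - 0 - m * t) + m * t)%R by ring.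
      eapply Rle_trans; [apply Rabs_triang|]. rewrite Rabs_mult, (Rabs_pos_eq t) by lra. lra. }
    apply A in B1. apply A in B2. unfold K, Re, Im in *. lra. }
  pose proof (sector_schwarz_radial alpha q q1 z t Ha Hz Hsv ltac:(lra)) as Hsch.
  cbv zeta in Hsch. fold w in Hsch.
  pose proof (rpow_sector_Re_pos alpha w Ha Hws) as HuRe.
  set (u := rpow (/ alpha) w) in *.
  destruct (one_le_Cmod_plus_1 u HuRe) as [Hu1 _].
  assert (Hu : (t <= 4 * Cmod u)%R).
  { assert (1 <= sqmod (u + 1)%C)%R by (rewrite sqmod_Cmod; nra).
    assert (Hre : (Re u <= Cmod u)%R)
      by (eapply Rle_trans; [apply Rle_abs|apply Rabs_Re_le]).
    assert (t * 1 <= (1 - (1 - t) ^ 2) * sqmod (u + 1)%C)%R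
      by (apply Rmult_le_compat; nra).
    lra. }
  unfold u in Hu. rewrite Cmod_rpow in Hu by exact Hw0.
  apply Cmod_gt_0 in Hw0.
  assert (L1 : (ln t <= ln 4 + / alpha * ln (Cmod w))%R).
  { rewrite <- (ln_exp (/ alpha * ln (Cmod w))), <- ln_mult by (try apply exp_pos; lra).
    apply ln_le; [exact Ht|exact Hu]. }
  assert (L2 : (ln (Cmod w) <= ln K + ln t)%R).
  { rewrite <- ln_mult by assumption. apply ln_le; assumption. }
  assert (L3 : (alpha * ln t <= alpha * ln 4 + ln (Cmod w))%R).
  { replace (alpha * ln 4 + ln (Cmod w))%R
      with (alpha * (ln 4 + / alpha * ln (Cmod w)))%R by (field; lra).
    apply Rmult_le_compat_l; lra. }
  assert (L4 : ((1 - alpha) * ln t <= - (T + 1))%R).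
  { replace (- (T + 1))%R with ((1 - alpha) * (- (T + 1) / (1 - alpha)))%R by (field; lra).
    apply Rmult_le_compat_l; lra. }
  unfold T in L4. lra.
Qed.

(** A form of the lemmas of Jack and Nunokawa. The real part of kappa vanishes
    because q moves into the sector along every direction that enters the disk,
    including directions arbitrarily close to the two tangents of the circle. The
    bound on the imaginary part is the Schwarz inequality, an equality at z itself,
    differentiated along the radius. *)
Lemma boundary_log_derivative (alpha x eps : R) (q q1 : C -> C) (z l : C) :
  (0 < alpha < 1)%R -> z <> 0 -> sector_valued alpha (Cmod z) q q1 -> cder q z l ->
  (0 < x)%R -> eps = 1%R \/ eps = (-1)%R ->
  q z = x * expi (eps * (PI * alpha / 2)) ->
  let s := exp (/ alpha * ln x) in
  let kappa := z * l / q z in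
  Re kappa = 0%R /\ (alpha * (s + / s) / 2 <= eps * Im kappa)%R.
Proof.
  intros Ha Hz Hsv Hl Hx He Eq s kappa.
  pose proof (half_angle alpha Ha) as Hbeta.
  destruct (cos_sin_pos _ Hbeta) as [Hcos Hsin].
  pose proof Hz as Hzp. apply Cmod_gt_0 in Hzp.
  set (beta := (PI * alpha / 2)%R) in *.
  assert (Hee : (eps * eps = 1)%R) by (destruct He as [-> | ->]; ring).
  assert (Hcs : (cos beta * cos beta + sin beta * sin beta = 1)%R).
  { pose proof (sin2_cos2 beta) as Hsc. unfold Rsqr in Hsc. lra. }
  assert (Eq2 : q z = (x * cos beta, x * (eps * sin beta))%R).
  { rewrite Eq. unfold expi. destruct He as [-> | ->].
    - rewrite Rmult_1_l. apply injective_projections; simpl; ring.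
    - replace (-1 * beta)%R with (- beta)%R by ring. rewrite cos_neg, sin_neg.
      apply injective_projections; simpl; ring. }
  assert (HqRe : (0 < Re (q z))%R).
  { rewrite Eq2. unfold Re. simpl. now apply Rmult_lt_0_compat. }
  assert (Hqn : q z <> 0) by (intros E; rewrite E in HqRe; simpl in HqRe; lra).
  assert (Ek : l * z = kappa * q z) by (unfold kappa; field; exact Hqn).
  split.
  - clearbody kappa. assert (Hdir : forall d : C, (fst d < 0)%R -> (eps * Im (kappa * d) <= 0)%R).
    { intros d Hd. destruct (Hl (z * d)) as [D1 D2].
      set (n := (fst d * fst d + snd d * snd d + 1)%R).
      assert (Hn : (1 <= n)%R) by (unfold n; nra).
      assert (Hx0 : (x * (eps * Im (kappa * d)) <= 0)%R).
      { apply (derive_nonpos_right (fun t : R =>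
           eps * cos beta * Im (q (z + t * (z * d))%C)
           - sin beta * Re (q (z + t * (z * d))%C))%R _ (- fst d / n)%R).
        - evar_last.
          + apply (is_derive_minus (V := R_NormedModule) _ _ _ _ _
             (is_derive_scal _ _ (eps * cos beta)%R _ D2)
             (is_derive_scal _ _ (sin beta) _ D1)).
          + replace (l * (z * d)) with (kappa * d * q z)
              by (transitivity (kappa * q z * d); [ring|rewrite <- Ek; ring]).
            rewrite Eq2. unfold minus, plus, opp. simpl.
            set (a := Re (kappa * d)). set (b := Im (kappa * d)).
            change (fst kappa * fst d - snd kappa * snd d)%R with a.
            change (fst kappa * snd d + snd kappa * fst d)%R with b.
            transitivity (x * (eps * b) * (cos beta * cos beta)
              + x * (eps * b) * (sin beta * sin beta)
              + x * a * cos beta * sin beta * (eps * eps - 1))%R; [ring|].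
            rewrite Hee. transitivity (x * (eps * b)
              * (cos beta * cos beta + sin beta * sin beta))%R; [ring|].
            rewrite Hcs. ring.
        - apply Rdiv_lt_0_compat; lra.
        - replace (z + 0%R * (z * d)) with z by ring. rewrite Eq2. simpl.
          transitivity (x * cos beta * sin beta * (eps * eps - 1))%R; [ring|].
          rewrite Hee. ring.
        - intros t Ht.
          assert (Htn : (t * n < - fst d)%R).
          { destruct Ht as [_ Ht]. apply Rmult_lt_compat_r with (r := n) in Ht; [|lra].
            replace (- fst d / n * n)%R with (- fst d)%R in Ht by (field; lra). exact Ht. }
          assert (Hin : (Cmod (z + t * (z * d)) < Cmod z)%R).
          { replace (z + t * (z * d)) with (z * (1 + t * d)) by ring.
            rewrite Cmod_mult. rewrite <- (Rmult_1_r (Cmod z)) at 2.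
            apply Rmult_lt_compat_l; [exact Hzp|].
            apply Rsqr_incrst_0; [|apply Cmod_ge_0|lra].
            unfold Rsqr. rewrite Cmod_sqr. unfold Re, Im. simpl.
            unfold n in Htn. nra. }
          pose proof (sv_sector _ _ _ _ Hsv _ Hin) as Hs. unfold sector in Hs.
          fold beta in Hs. set (w := q (z + t * (z * d))) in *.
          assert (Hei : (eps * Im w <= Rabs (Im w))%R).
          { destruct He as [-> | ->].
            - rewrite Rmult_1_l. apply Rle_abs.
            - rewrite <- Rabs_Ropp. replace (-1 * Im w)%R with (- Im w)%R by ring.
              apply Rle_abs. }
          nra. }
      nra. }
    apply NNPP. intros Hk1.
    set (k1 := Re kappa) in *. set (k2 := Im kappa).
    assert (Hk1p : (0 < Rabs k1)%R) by now apply Rabs_pos_lt.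
    set (dd := (Rabs k1 / (2 * (Rabs k2 + 1)))%R).
    pose proof (Rabs_pos k2) as Hk2p.
    assert (Hdd : (0 < dd)%R) by (apply Rdiv_lt_0_compat; lra).
    assert (Hd2 : (dd * Rabs k2 < Rabs k1)%R).
    { assert (Ed : (dd * (2 * (Rabs k2 + 1)) = Rabs k1)%R) by (unfold dd; field; lra). nra. }
    assert (P1 : (eps * (k1 * 1 + k2 * - dd) <= 0)%R)
      by (apply (Hdir ((- dd)%R, 1%R)); simpl; lra).
    assert (P2 : (eps * (k1 * -1 + k2 * - dd) <= 0)%R)
      by (apply (Hdir ((- dd)%R, (-1)%R)); simpl; lra).
    assert (P3 : (0 <= dd * Rabs k2)%R) by (apply Rmult_le_pos; lra).
    clearbody dd. revert Hd2 P1 P2 P3. unfold Rabs. clear - He.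
    destruct (Rcase_abs k1), (Rcase_abs k2); intros; destruct He as [-> | ->]; nra.
  - pose proof (cder_rpow (/ alpha) q z l Hl HqRe) as HU.
    set (U := fun w => rpow (/ alpha) (q w)) in *.
    assert (EU : U z = (0%R, (eps * s)%R)).
    { unfold U. rewrite Eq. now apply rpow_sector_side. }
    assert (Hsp : (0 < s)%R) by apply exp_pos.
    destruct (HU (- z)) as [D1 D2].
    assert (Ev : RtoC (/ alpha) * rpow (/ alpha) (q z) * l / q z * - z
                 = - ((/ alpha)%R * (U z * kappa))).
    { unfold U, kappa. field. exact Hqn. }
    rewrite Ev, EU in D1, D2. clear Ev Ek. clearbody kappa.
    assert (Hm : (2 * (1 + s * s) - 4 * (/ alpha * s * (eps * Im kappa)) <= 0)%R).
    { apply (derive_nonpos_right (fun t : R =>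
        (1 - (1 - t) ^ 2) * sqmod (U (z + t * (- z)) + 1)%C
         - 4 * Re (U (z + t * (- z))%C))%R _ 1%R).
      - set (X := fun t : R => Re (U (z + t * - z))) in *.
        set (Y := fun t : R => Im (U (z + t * - z))) in *.
        set (dx := Re (- ((/ alpha)%R * ((0%R, (eps * s)%R) * kappa)))) in *.
        set (dy := Im (- ((/ alpha)%R * ((0%R, (eps * s)%R) * kappa)))) in *.
        change (is_derive (fun t => (1 - (1 - t) ^ 2) * ((X t + 1) ^ 2 + (Y t + 0) ^ 2)
                  - 4 * X t)%R 0%R
          (2 * (1 + s * s) - 4 * (/ alpha * s * (eps * Im kappa)))%R).
        assert (EX : X 0%R = 0%R /\ Y 0%R = (eps * s)%R).
        { unfold X, Y. replace (z + 0%R * - z) with z by ring. rewrite EU. split; reflexivity. }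
        destruct EX as [EX EY].
        derive_from_components. rewrite EX, EY.
        transitivity (2 * (1 + eps * eps * s * s) - 4 * dx)%R; [ring|].
        rewrite Hee. unfold dx, Re, Im. simpl. ring.
      - lra.
      - replace (z + 0%R * - z) with z by ring. rewrite EU. unfold Re. simpl. ring.
      - intros t Ht. pose proof (sector_schwarz_radial alpha q q1 z t Ha Hz Hsv Ht) as HS.
        cbv zeta in HS. unfold U. lra. }
    assert (Hmul : (alpha * (1 + s * s) <= 2 * s * (eps * Im kappa))%R).
    { assert (E : (4 * (/ alpha * s * (eps * Im kappa)) * alpha
                   = 2 * (2 * s * (eps * Im kappa)))%R) by (field; lra). nra. }
    apply Rmult_le_reg_l with (2 * s)%R; [lra|].
    replace (2 * s * (alpha * (s + / s) / 2))%R with (alpha * (1 + s * s))%R by (field; lra).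
    lra.
Qed.

(** * The starlike quotient of the shifted hypergeometric function *)

Lemma powser_plus (A B : nat -> C) (z : C) :
  tempered A -> tempered B -> (Cmod z < 1)%R ->
  powser (fun n => A n + B n) z = powser A z + powser B z.
Proof.
  intros HA HB Hz. apply is_series_cseries.
  eapply is_series_ext;
    [|apply (is_series_plus _ _ _ _ (is_series_powser A z HA Hz) (is_series_powser B z HB Hz))].
  intros n. change (A n * z ^ n + B n * z ^ n = (A n + B n) * z ^ n). ring.
Qed.

Lemma powser_euler_euler (A : nat -> C) (z : C) : tempered A -> (Cmod z < 1)%R ->
  powser (euler_coef (euler_coef A)) z
  = z * (powser (dcoef A) z + z * powser (dcoef (dcoef A)) z).
Proof.
  intros HA Hz. pose proof (tempered_dcoef A HA) as Hd.
  rewrite powser_euler by (try apply tempered_euler_coef; assumption).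
  rewrite <- (powser_euler (dcoef A) z Hd Hz).
  rewrite <- powser_plus by (try apply tempered_euler_coef; assumption).
  f_equal. unfold powser. f_equal.
  apply functional_extensionality. intros n. f_equal.
  unfold dcoef, euler_coef. rewrite !S_INR, !RtoC_plus. ring.
Qed.

(** With F1 = F', this is z f'/f for f = z F. *)
Definition quot (F F1 : C -> C) (z : C) : C := 1 + z * F1 z * / F z.

Definition quot_der (F F1 F2 : C -> C) (z : C) : C :=
  F1 z * / F z + z * F2 z * / F z - z * (F1 z * F1 z) * (/ F z * / F z).

Lemma cder_quot (F F1 F2 : C -> C) (z : C) :
  cder F z (F1 z) -> cder F1 z (F2 z) -> F z <> 0 ->
  cder (quot F F1) z (quot_der F F1 F2 z).
Proof.
  intros H H1 Hz. unfold quot, quot_der.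
  match goal with |- cder _ _ ?l => replace l with
    (0 + ((1 * F1 z + z * F2 z) * / F z
          + z * F1 z * (- F1 z / (F z * F z)))) by (field; exact Hz) end.
  apply (cder_plus (fun _ => 1) (fun w => w * F1 w * / F w)); [apply cder_const|].
  apply (cder_mult (fun w => w * F1 w) (fun w => / F w)).
  - apply (cder_mult (fun w => w)); [apply cder_id|exact H1].
  - now apply cder_inv.
Qed.

Lemma ex_cder_quot_der (F F1 F2 F3 : C -> C) (z : C) :
  cder F z (F1 z) -> cder F1 z (F2 z) -> cder F2 z (F3 z) -> F z <> 0 ->
  exists l, cder (quot_der F F1 F2) z l.
Proof.
  intros H H1 H2 Hz. pose proof (cder_inv F z _ H Hz) as HI.
  pose proof (cder_id z) as Hid.
  assert (E : quot_der F F1 F2 = fun w => F1 w * / F w + w * F2 w * / F w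
     + (-1) * (w * (F1 w * F1 w) * (/ F w * / F w))).
  { apply functional_extensionality. intros w. unfold quot_der. ring. }
  rewrite E. eexists. apply cder_plus; [apply cder_plus|].
  - apply cder_mult; eassumption.
  - apply cder_mult; [apply cder_mult|]; eassumption.
  - apply (cder_mult (fun _ => -1)); [apply cder_const|].
    apply cder_mult; apply cder_mult; try eassumption.
    apply cder_mult; eassumption.
Qed.

Lemma cdiff_ccont (f : C -> C) (z l : C) : cdiff f z l -> ccont f z.
Proof.
  intros H eps Heps. destruct (H 1%R Rlt_0_1) as [d [Hd Hh]].
  set (K := (Cmod l + 2)%R).
  assert (HK : (0 < K)%R) by (unfold K; pose proof (Cmod_ge_0 l); lra).
  exists (Rmin d (eps / K)). split; [apply Rmin_pos; [exact Hd|now apply Rdiv_lt_0_compat]|].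
  intros w Hw. specialize (Hh (w - z)). replace (z + (w - z)) with w in Hh by ring.
  specialize (Hh ltac:(eapply Rlt_le_trans; [exact Hw|apply Rmin_l])).
  assert (Hw2 : (Cmod (w - z) < eps / K)%R)
    by (eapply Rlt_le_trans; [exact Hw|apply Rmin_r]).
  assert (Hw3 : (Cmod (w - z) * K < eps)%R).
  { apply Rmult_lt_compat_r with (r := K) in Hw2; [|exact HK].
    replace (eps / K * K)%R with eps in Hw2 by (field; lra). exact Hw2. }
  replace (f w - f z) with ((f w - f z - l * (w - z)) + l * (w - z)) by ring.
  eapply Rle_lt_trans; [apply Cmod_triangle|]. rewrite Cmod_mult.
  pose proof (Cmod_ge_0 (w - z)). unfold K in Hw3. lra.
Qed.

Lemma ccont_locally_bounded (f : C -> C) (z : C) : ccont f z -> locally_bounded f z.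
Proof.
  intros H. destruct (H 1%R Rlt_0_1) as [d [Hd Hw]].
  exists (1 + Cmod (f z))%R, d. split; [exact Hd|]. intros w Hwd. specialize (Hw w Hwd).
  replace (f w) with ((f w - f z) + f z) by ring.
  eapply Rle_trans; [apply Cmod_triangle|]. lra.
Qed.

Lemma locally_bounded_plus (f g : C -> C) (z : C) :
  locally_bounded f z -> locally_bounded g z -> locally_bounded (fun w => f w + g w) z.
Proof.
  intros (K1 & d1 & Hd1 & H1) (K2 & d2 & Hd2 & H2).
  exists (K1 + K2)%R, (Rmin d1 d2). split; [now apply Rmin_pos|]. intros w Hw.
  eapply Rle_trans; [apply Cmod_triangle|]. apply Rplus_le_compat.
  - apply H1. eapply Rlt_le_trans; [exact Hw|apply Rmin_l].
  - apply H2. eapply Rlt_le_trans; [exact Hw|apply Rmin_r].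
Qed.

Lemma locally_bounded_mult (f g : C -> C) (z : C) :
  locally_bounded f z -> locally_bounded g z -> locally_bounded (fun w => f w * g w) z.
Proof.
  intros (K1 & d1 & Hd1 & H1) (K2 & d2 & Hd2 & H2).
  exists (K1 * K2)%R, (Rmin d1 d2). split; [now apply Rmin_pos|]. intros w Hw.
  rewrite Cmod_mult. apply Rmult_le_compat; try apply Cmod_ge_0.
  - apply H1. eapply Rlt_le_trans; [exact Hw|apply Rmin_l].
  - apply H2. eapply Rlt_le_trans; [exact Hw|apply Rmin_r].
Qed.

Lemma ccont_nonzero (f : C -> C) (z : C) : ccont f z -> f z <> 0 ->
  exists d, (0 < d)%R /\ forall w, (Cmod (w - z) < d)%R -> (Cmod (f z) / 2 <= Cmod (f w))%R.
Proof.
  intros H Hz. apply Cmod_gt_0 in Hz.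
  destruct (H (Cmod (f z) / 2)%R) as [d [Hd Hw]]; [lra|].
  exists d. split; [exact Hd|]. intros w Hwd. specialize (Hw w Hwd).
  pose proof (Cmod_triangle (f z - f w) (f w)) as Ht.
  replace (f z - f w + f w) with (f z) in Ht by ring.
  replace (f z - f w) with (- (f w - f z)) in Ht by ring. rewrite Cmod_opp in Ht. lra.
Qed.

Lemma locally_bounded_inv (f : C -> C) (z : C) :
  ccont f z -> f z <> 0 -> locally_bounded (fun w => / f w) z.
Proof.
  intros H Hz. destruct (ccont_nonzero f z H Hz) as [d [Hd Hw]].
  apply Cmod_gt_0 in Hz.
  exists (/ (Cmod (f z) / 2))%R, d. split; [exact Hd|]. intros w Hwd. specialize (Hw w Hwd).
  rewrite Cmod_inv by (apply Cmod_gt_0; lra). apply Rinv_le_contravar; lra.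
Qed.

Lemma locally_bounded_quot_der (F F1 F2 : C -> C) (z : C) :
  ccont F z -> ccont F1 z -> ccont F2 z -> F z <> 0 ->
  locally_bounded (quot_der F F1 F2) z.
Proof.
  intros H H1 H2 Hz. pose proof (locally_bounded_inv F z H Hz) as HI.
  apply ccont_locally_bounded in H1. apply ccont_locally_bounded in H2.
  pose proof (ccont_locally_bounded _ z (ccont_id z)) as Hid.
  assert (E : quot_der F F1 F2 = fun w => F1 w * / F w + w * F2 w * / F w
     + (-1) * (w * (F1 w * F1 w) * (/ F w * / F w))).
  { apply functional_extensionality. intros w. unfold quot_der. ring. }
  rewrite E.
  assert (Hc : locally_bounded (fun _ => -1) z).
  { exists (Cmod (-1)), 1%R. split; [lra|]. intros w _. apply Rle_refl. }
  apply (locally_bounded_plus (fun w => F1 w * / F w + w * F2 w * / F w)).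
  - apply (locally_bounded_plus (fun w => F1 w * / F w)).
    + now apply locally_bounded_mult.
    + apply (locally_bounded_mult (fun w => w * F2 w)); [|exact HI].
      now apply (locally_bounded_mult (fun w => w)).
  - apply (locally_bounded_mult (fun _ => -1)); [exact Hc|].
    apply (locally_bounded_mult (fun w => w * (F1 w * F1 w))).
    + apply (locally_bounded_mult (fun w => w)); [exact Hid|].
      now apply locally_bounded_mult.
    + now apply locally_bounded_mult.
Qed.

(** The Riccati equation of q = z f'/f: divide the Euler form of the hypergeometric
    equation by F, using theta F = (q-1) F and
    theta (theta F) = (theta q + (q-1)^2) F. *)
Lemma quot_equation (a b c z : C) (p : R) :
  (forall n : nat, c <> - INR n) -> (Cmod z < 1)%R -> RtoC p = a + b + 1 - c ->
  let A := hyp_coef a b c in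
  let F := powser A in
  let F1 := powser (dcoef A) in
  let F2 := powser (dcoef (dcoef A)) in
  F z <> 0 ->
  let q := quot F F1 z in
  let N := z * quot_der F F1 F2 z + (q - 1) * (q + c - 2) in
  N = z * (N + (p * q + (a * b - p))).
Proof.
  intros Hc Hz Hp A F F1 F2 Hn q N.
  pose proof (tempered_hyp_coef a b c Hc) as HA. fold A in HA.
  pose proof (hyp_euler_equation a b c z Hc Hz) as HE. cbv zeta in HE. fold A in HE.
  rewrite powser_euler_euler in HE by assumption.
  rewrite powser_euler in HE by assumption.
  fold F F1 F2 in HE. change (powser A z) with (F z) in HE.
  change (powser (dcoef A) z) with (F1 z) in HE.
  change (powser (dcoef (dcoef A)) z) with (F2 z) in HE.
  assert (EN : N = (z * (F1 z + z * F2 z) + (c - 1) * (z * F1 z)) / F z).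
  { unfold N, q, quot, quot_der. field. exact Hn. }
  assert (ED : N + (p * q + (a * b - p))
     = (z * (F1 z + z * F2 z) + (a + b) * (z * F1 z) + a * b * F z) / F z).
  { rewrite EN, Hp. unfold q, quot. field. exact Hn. }
  rewrite ED, EN, HE. field. exact Hn.
Qed.

(** This is the origin of G. The first argument of sqmod factors as
    (q-1+a)(q-1+b), and each |q + w|^2 is quadratic in x = |q| with coefficients in
    rot_re and |w|^2; the terms x^4 cancel. *)
Lemma G_sqmod (alpha x eps p : R) (a b c : C) :
  eps = 1%R \/ eps = (-1)%R -> RtoC p = a + b + 1 - c ->
  let q := x * expi (eps * (PI * alpha / 2)) in
  G alpha a b c p eps x
  = (sqmod ((q - 1) * (q + c - 2) + (p * q + (a * b - p)))%C
     - sqmod ((q - 1) * (q + c - 2))%C)%R.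
Proof.
  intros He Hp q.
  replace ((q - 1) * (q + c - 2) + (p * q + (a * b - p)))
    with ((q - 1 + a) * (q - 1 + b)) by (rewrite Hp; ring).
  assert (Ec : c = a + b + 1 - p) by (rewrite Hp; ring).
  set (beta := (PI * alpha / 2)%R) in *.
  set (C0 := cos beta). set (S0 := sin (eps * beta)).
  assert (EC : cos (eps * beta) = C0).
  { destruct He as [-> | ->]; [now rewrite Rmult_1_l|].
    replace (-1 * beta)%R with (- beta)%R by ring. apply cos_neg. }
  assert (Hcs : (S0 * S0 = 1 - C0 * C0)%R).
  { pose proof (sin2_cos2 (eps * beta)) as Hsc. unfold Rsqr in Hsc.
    rewrite EC in Hsc. unfold S0. lra. }
  assert (Eq : q = (x * C0, x * S0)%R).
  { unfold q, expi. rewrite EC. fold S0. apply injective_projections; simpl; ring. }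
  assert (Hrot : forall w, rot_re alpha eps w = (fst w * C0 + snd w * S0)%R).
  { intros w. unfold rot_re, expi. fold beta. rewrite cos_neg, sin_neg, EC. fold S0.
    unfold Re. simpl. ring. }
  assert (Hlin : forall w : C, sqmod (q + w)%C
     = (x * x + 2 * x * (fst w * C0 + snd w * S0) + (fst w * fst w + snd w * snd w))%R).
  { intros w. rewrite Eq. unfold sqmod, Re, Im. simpl.
    transitivity (x * x * (C0 * C0 + S0 * S0) + 2 * x * (fst w * C0 + snd w * S0)
       + (fst w * fst w + snd w * snd w))%R; [ring|]. rewrite Hcs. ring. }
  assert (Hmul : forall u v : C, sqmod (u * v)%C = (sqmod u * sqmod v)%R).
  { intros u v. unfold sqmod, Re, Im. simpl. ring. }
  rewrite !Hmul.
  replace (q - 1 + a) with (q + (a - 1)) by ring.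
  replace (q - 1 + b) with (q + (b - 1)) by ring.
  replace (q + c - 2) with (q + (c - 2)) by ring.
  replace (q - 1) with (q + (- 1)) by ring.
  rewrite !Hlin. unfold G, G_S, G_T, G_U, G_V. fold beta. fold C0.
  rewrite !Hrot, !Cmod2_alt. rewrite Ec. unfold Re, Im. simpl. ring.
Qed.

Lemma Re_mul_expi_side (alpha eps : R) (P : C) : eps = 1%R \/ eps = (-1)%R ->
  Re (P * expi (eps * (PI * (1 - alpha) / 2)))
  = (Re P * sin (PI * alpha / 2) - eps * Im P * cos (PI * alpha / 2))%R.
Proof.
  intros He. unfold expi, Re, Im. simpl.
  replace (PI * (1 - alpha) / 2)%R with (PI / 2 - PI * alpha / 2)%R by field.
  destruct He as [-> | ->].
  - rewrite Rmult_1_l, cos_shift, sin_shift. ring.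
  - replace (-1 * (PI / 2 - PI * alpha / 2))%R
      with (- (PI / 2 - PI * alpha / 2))%R by ring.
    rewrite cos_neg, sin_neg, cos_shift, sin_shift. ring.
Qed.

(** Let N = theta + (q-1)(q+c-2), P = ab - p and D = p q + P. As p is real, the
    cross term 2 Re (conj D theta) of |N + D|^2 - |N|^2 involves P only, and the
    assumed bound on G gives |N + D| <= |N|, whereas N = z (N + D) with |z| < 1. So
    N = D = 0, and P = - p q is on a side of the sector or of its opposite, or
    zero. *)
Lemma side_contradiction (alpha x mu eps p : R) (a b c z theta q : C) :
  (0 < alpha < 1)%R -> (0 < x)%R -> eps = 1%R \/ eps = (-1)%R -> (Cmod z < 1)%R ->
  RtoC p = a + b + 1 - c -> sector (PI * alpha / 2) (a * b - p) ->
  q = x * expi (eps * (PI * alpha / 2)) ->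
  theta = (0%R, (eps * mu)%R) * q ->
  (G alpha a b c p eps x
    <= 2 * mu * x * Re ((a * b - p) * expi (eps * (PI * (1 - alpha) / 2)))%C)%R ->
  theta + (q - 1) * (q + c - 2)
    = z * (theta + (q - 1) * (q + c - 2) + (p * q + (a * b - p))) ->
  False.
Proof.
  intros Ha Hx He Hz Hp Hs Eq Et HG HN.
  pose proof (half_angle alpha Ha) as Hbeta.
  destruct (cos_sin_pos _ Hbeta) as [Hcos Hsin].
  pose proof (G_sqmod alpha x eps p a b c He Hp) as EG. cbv zeta in EG. rewrite <- Eq in EG.
  rewrite EG, Re_mul_expi_side in HG by exact He.
  set (P := a * b - p) in *. set (beta := (PI * alpha / 2)%R) in *.
  set (E := (q - 1) * (q + c - 2)) in *. set (D := p * q + P) in *.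
  assert (Eq2 : q = (x * cos beta, x * (eps * sin beta))%R).
  { rewrite Eq. unfold expi. destruct He as [-> | ->].
    - rewrite Rmult_1_l. apply injective_projections; simpl; ring.
    - replace (-1 * beta)%R with (- beta)%R by ring. rewrite cos_neg, sin_neg.
      apply injective_projections; simpl; ring. }
  assert (Hee : (eps * eps = 1)%R) by (destruct He as [-> | ->]; ring).
  assert (Hle : (sqmod (theta + E + D)%C <= sqmod (theta + E)%C)%R).
  { assert (Hid : (sqmod (theta + E + D)%C - sqmod (theta + E)%C
       = sqmod (E + D)%C - sqmod E
         + 2 * (Re D * Re theta + Im D * Im theta))%R).
    { clearbody D E. unfold sqmod, Re, Im. simpl. ring. }
    assert (HD : (Re D * Re theta + Im D * Im theta
       = - (mu * x * (Re P * sin beta - eps * Im P * cos beta)))%R).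
    { rewrite Et. unfold D. rewrite Eq2. clearbody P. unfold Re, Im. simpl.
      transitivity (- (mu * x * (fst P * sin beta * (eps * eps) - eps * snd P * cos beta)))%R;
        [ring|]. rewrite Hee. ring. }
    rewrite HD in Hid. lra. }
  rewrite !sqmod_Cmod in Hle.
  assert (HC : Cmod (theta + E) = (Cmod z * Cmod (theta + E + D))%R)
    by (rewrite <- Cmod_mult; f_equal; exact HN).
  pose proof (Cmod_ge_0 z) as Hz0. pose proof (Cmod_ge_0 (theta + E + D)) as HM0.
  assert (HM : Cmod (theta + E + D) = 0%R).
  { destruct (Req_dec (Cmod (theta + E + D)) 0) as [H|H]; [exact H|exfalso].
    rewrite HC, Rpow_mult_distr in Hle.
    assert (0 < Cmod (theta + E + D) ^ 2)%R by (apply pow_lt; lra).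
    assert (Cmod z ^ 2 < 1)%R by nra. nra. }
  rewrite HM, Rmult_0_r in HC. apply Cmod_eq_0 in HC. apply Cmod_eq_0 in HM.
  assert (ED : P = - (p * q)).
  { assert (D = 0) as D0; [|unfold D in D0].
    - transitivity (theta + E + D - (theta + E)); [ring|]. rewrite HM, HC. ring.
    - transitivity (p * q + P - p * q); [ring|]. rewrite D0. ring. }
  unfold sector in Hs. rewrite ED, Eq2 in Hs. unfold Re, Im in Hs. simpl in Hs.
  assert (Habs : (Rabs (- (p * (x * (eps * sin beta)) + 0 * (x * cos beta)))
                  = Rabs p * (x * sin beta))%R).
  { rewrite Rabs_Ropp. replace (p * (x * (eps * sin beta)) + 0 * (x * cos beta))%R
      with (p * eps * (x * sin beta))%R by ring.
    rewrite !Rabs_mult, (Rabs_pos_eq x), (Rabs_pos_eq (sin beta)) by lra.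
    assert (Rabs eps = 1)%R as ->; [|ring].
    destruct He as [-> | ->]; [apply Rabs_R1|rewrite Rabs_left; lra]. }
  rewrite Habs in Hs.
  assert (Hpos : (0 < x * sin beta * cos beta)%R) by now repeat apply Rmult_lt_0_compat.
  pose proof (Rle_abs (- p)) as Hp2. rewrite Rabs_Ropp in Hp2. nra.
Qed.

Lemma sector_open (beta : R) (w : C) : (0 < beta < PI / 2)%R -> sector beta w ->
  exists d, (0 < d)%R /\ forall v, (Cmod (v - w) < d)%R -> sector beta v.
Proof.
  intros Hbeta Hw. unfold sector in *. destruct (cos_sin_pos _ Hbeta) as [Hcos Hsin].
  exists ((Re w * sin beta - Rabs (Im w) * cos beta) / 2)%R. split; [lra|].
  intros v Hv. set (d := Cmod (v - w)) in *.
  assert (H1 : (Rabs (Re v - Re w) <= d)%R).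
  { eapply Rle_trans; [|apply (Rabs_Re_le (v - w))]. right. f_equal. }
  assert (H2 : (Rabs (Im v) <= Rabs (Im w) + d)%R).
  { replace (Im v) with (Im w + (Im v - Im w))%R by ring.
    eapply Rle_trans; [apply Rabs_triang|]. apply Rplus_le_compat_l.
    eapply Rle_trans; [|apply (Rabs_Im_le (v - w))]. right. f_equal. }
  apply Rabs_le_between in H1.
  pose proof (COS_bound beta) as Hc1. pose proof (SIN_bound beta) as Hs1.
  assert (Hd : (0 <= d)%R) by apply Cmod_ge_0.
  nra.
Qed.

(** By continuity |Im w| cos beta = Re w sin beta, and w <> 0 then forces
    Re w > 0; eps is the sign of Im w. *)
Lemma sector_limit_side (beta : R) (w : C) : (0 < beta < PI / 2)%R ->
  w <> 0 -> ~ sector beta w ->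
  (forall d, (0 < d)%R -> exists v, (Cmod (v - w) < d)%R /\ sector beta v) ->
  exists x eps, (0 < x)%R /\ (eps = 1%R \/ eps = (-1)%R) /\ w = x * expi (eps * beta).
Proof.
  intros Hbeta Hw Hn Hlim. unfold sector in *.
  destruct (cos_sin_pos _ Hbeta) as [Hcos Hsin]. apply Rnot_lt_le in Hn.
  assert (Heq : (Rabs (Im w) * cos beta = Re w * sin beta)%R).
  { apply Rle_antisym; [|exact Hn]. apply Rnot_lt_le. intros Hgt.
    destruct (Hlim ((Rabs (Im w) * cos beta - Re w * sin beta) / 2)%R) as [v [Hv Hvs]]; [lra|].
    set (d := Cmod (v - w)) in *.
    assert (H1 : (Rabs (Re v - Re w) <= d)%R).
    { eapply Rle_trans; [|apply (Rabs_Re_le (v - w))]. right. f_equal. }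
    assert (H2 : (Rabs (Im w) <= Rabs (Im v) + d)%R).
    { replace (Im w) with (Im v - (Im v - Im w))%R by ring.
      eapply Rle_trans; [apply Rabs_triang|]. rewrite Rabs_Ropp. apply Rplus_le_compat_l.
      eapply Rle_trans; [|apply (Rabs_Im_le (v - w))]. right. f_equal. }
    apply Rabs_le_between in H1.
    pose proof (COS_bound beta) as Hc1. pose proof (SIN_bound beta) as Hs1.
    assert (Hd : (0 <= d)%R) by apply Cmod_ge_0.
    nra. }
  assert (HRe : (0 < Re w)%R).
  { pose proof (Rabs_pos (Im w)) as Hp. apply Rnot_le_lt. intros Hle.
    assert (Rabs (Im w) = 0)%R by nra. assert (Re w = 0)%R by nra.
    apply Hw. apply injective_projections; [exact H0|].
    destruct (Req_dec (Im w) 0) as [E|E]; [exact E|]. apply Rabs_no_R0 in E. contradiction. }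
  set (x := (Re w / cos beta)%R).
  assert (Hx : (0 < x)%R) by now apply Rdiv_lt_0_compat.
  assert (E1 : Re w = (x * cos beta)%R) by (unfold x; field; lra).
  assert (E2 : Rabs (Im w) = (x * sin beta)%R).
  { apply Rmult_eq_reg_r with (cos beta); [|lra]. rewrite Heq, E1. ring. }
  destruct (Rle_dec 0 (Im w)) as [Hi|Hi].
  - exists x, 1%R. split; [exact Hx|]. split; [now left|].
    rewrite Rabs_pos_eq in E2 by exact Hi. rewrite Rmult_1_l. unfold expi, Re, Im in *.
    apply injective_projections; simpl; lra.
  - exists x, (-1)%R. split; [exact Hx|]. split; [now right|].
    rewrite Rabs_left in E2 by lra. replace (-1 * beta)%R with (- beta)%R by ring.
    unfold expi, Re, Im in *. rewrite cos_neg, sin_neg.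
    apply injective_projections; simpl; lra.
Qed.

(** |z F(z)| increases along each radius, because Re (z f'/f) > 0. *)
Lemma quot_Re_pos_neq_0 (F F1 : C -> C) (z : C) : z <> 0 ->
  (forall w, (Cmod w <= Cmod z)%R -> cder F w (F1 w)) ->
  (forall w, (Cmod w < Cmod z)%R -> F w <> 0 /\ (0 < Re (quot F F1 w))%R) ->
  F z <> 0.
Proof.
  intros Hz Hd Hin HF. pose proof Hz as Hzp. apply Cmod_gt_0 in Hzp.
  set (f := fun w => w * F w).
  set (H := fun t : R => sqmod (f (0 + t * z))).
  set (f1 := fun w => 1 * F w + w * F1 w).
  set (H1 := fun t : R => (2 * (Re (f (0 + t * z)%C) * Re (f1 (0 + t * z)%C * z)
      + Im (f (0 + t * z)%C) * Im (f1 (0 + t * z)%C * z)))%R).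
  assert (Hmod : forall t : R, (0 <= t)%R -> Cmod (0 + t * z) = (t * Cmod z)%R).
  { intros t Ht. rewrite Cplus_0_l, Cmod_mult, Cmod_R, Rabs_pos_eq by exact Ht. reflexivity. }
  assert (HD : forall t : R, (0 <= t <= 1)%R -> derivable_pt_lim H t (H1 t)).
  { intros t Ht. apply is_derive_Reals.
    assert (Hc : cder f (0 + t * z) (f1 (0 + t * z))).
    { apply (cder_mult (fun w => w)); [apply cder_id|]. apply Hd. rewrite Hmod by lra. nra. }
    destruct (cder_line f 0 z _ t Hc) as [D1 D2].
    set (X := fun t : R => Re (f (0 + t * z))) in *.
    set (Y := fun t : R => Im (f (0 + t * z))) in *.
    unfold H, H1, sqmod.
    change (is_derive (fun t => X t ^ 2 + Y t ^ 2)%R t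
      (2 * (X t * Re (f1 (0 + t * z)%C * z) + Y t * Im (f1 (0 + t * z)%C * z)))%R).
    derive_from_components. ring. }
  destruct (MVT_cor2 H H1 (/ 2) 1) as [t [Ht1 Ht2]]; [lra|intros t Ht; apply HD; lra|].
  assert (Hw : (Cmod (0 + t * z) < Cmod z)%R) by (rewrite Hmod by lra; nra).
  destruct (Hin _ Hw) as [HFn HRe]. set (w := 0 + t * z) in *.
  assert (Hge : (0 <= H1 t)%R).
  { assert (E : f1 w * z = (/ t)%R * (quot F F1 w * f w)).
    { rewrite RtoC_inv by lra. unfold f1, f, quot.
      replace z with (/ t * w).
      - field. split; [exact HFn|]. intros E. apply RtoC_inj in E. lra.
      - unfold w. field. intros E. apply RtoC_inj in E. lra. }
    unfold H1. fold w. rewrite E.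
    replace (2 * (Re (f w) * Re ((/ t)%R * (quot F F1 w * f w))
      + Im (f w) * Im ((/ t)%R * (quot F F1 w * f w))))%R
      with (2 * (/ t * Re (quot F F1 w) * sqmod (f w)))%R
      by (unfold sqmod, Re, Im; simpl; ring).
    assert (0 < / t)%R by (apply Rinv_0_lt_compat; lra).
    assert (0 <= sqmod (f w))%R by (rewrite sqmod_Cmod; apply pow_le, Cmod_ge_0).
    repeat apply Rmult_le_pos; lra. }
  assert (HH1 : H 1%R = 0%R).
  { unfold H, f. replace (0 + 1%R * z) with z by ring. rewrite HF.
    unfold sqmod, Re, Im. simpl. ring. }
  assert (HH2 : (0 < H (/ 2))%R).
  { unfold H. apply sqmod_pos. unfold f. apply Cmult_neq_0.
    - apply Cmod_gt_0. rewrite Hmod by lra. lra.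
    - apply Hin. rewrite Hmod by lra. lra. }
  rewrite HH1 in Ht1. nra.
Qed.

(** The first-contact argument, at a point of least modulus at which F vanishes or
    q is outside the sector. *)
Lemma quot_in_sector (alpha : R) (a b c : C) (p : R) :
  (0 < alpha < 1)%R -> (forall n : nat, c <> - INR n) -> RtoC p = a + b + 1 - c ->
  sector (PI * alpha / 2) (a * b - p) ->
  (forall s eps : R, (0 < s)%R -> eps = 1%R \/ eps = (-1)%R ->
     (G alpha a b c p eps (Rpower s alpha)
      <= alpha * (s + / s) * Rpower s alpha
         * Re ((a * b - p) * expi (eps * (PI * (1 - alpha) / 2)))%C)%R) ->
  let F := powser (hyp_coef a b c) in
  let F1 := powser (dcoef (hyp_coef a b c)) in
  forall z, (Cmod z < 1)%R -> F z <> 0 /\ sector (PI * alpha / 2) (quot F F1 z).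
Proof.
  intros Ha Hc Hp HP HG F F1 z1 Hz1.
  pose proof (half_angle alpha Ha) as Hbeta.
  destruct (cos_sin_pos _ Hbeta) as [Hcos Hsin].
  pose proof (tempered_hyp_coef a b c Hc) as HA0.
  pose proof (tempered_dcoef _ HA0) as HA1.
  pose proof (tempered_dcoef _ HA1) as HA2.
  set (F2 := powser (dcoef (dcoef (hyp_coef a b c)))).
  set (F3 := powser (dcoef (dcoef (dcoef (hyp_coef a b c))))).
  assert (HF : forall z, (Cmod z < 1)%R -> cdiff F z (F1 z))
    by (intros z Hz; now apply cdiff_powser).
  assert (HF1 : forall z, (Cmod z < 1)%R -> cdiff F1 z (F2 z))
    by (intros z Hz; now apply cdiff_powser).
  assert (HF2 : forall z, (Cmod z < 1)%R -> cdiff F2 z (F3 z))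
    by (intros z Hz; now apply cdiff_powser).
  set (q := quot F F1). set (q1 := quot_der F F1 F2).
  assert (Hq : forall z, (Cmod z < 1)%R -> F z <> 0 -> cder q z (q1 z)).
  { intros z Hz Hn. apply cder_quot; [apply cdiff_cder..|]; auto. }
  assert (Hqb : forall z, (Cmod z < 1)%R -> F z <> 0 -> locally_bounded q1 z).
  { intros z Hz Hn. apply locally_bounded_quot_der; [eapply cdiff_ccont; eauto..|exact Hn]. }
  assert (HFn : forall z, (Cmod z < 1)%R -> F z <> 0 ->
    exists d, (0 < d)%R /\ forall w, (Cmod (w - z) < d)%R -> (Cmod w < 1)%R /\ F w <> 0).
  { intros z Hz Hn.
    destruct (ccont_nonzero F z (cdiff_ccont F z _ (HF z Hz)) Hn) as [d [Hd Hw]].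
    exists (Rmin d (1 - Cmod z)). split; [apply Rmin_pos; lra|]. intros w Hlt. split.
    - pose proof (Cmod_triangle (w - z) z) as Ht. replace (w - z + z) with w in Ht by ring.
      pose proof (Rmin_r d (1 - Cmod z)). lra.
    - apply Cmod_gt_0 in Hn. apply Cmod_gt_0.
      specialize (Hw w ltac:(eapply Rlt_le_trans; [exact Hlt|apply Rmin_l])). lra. }
  assert (Hqc : forall z, (Cmod z < 1)%R -> F z <> 0 -> ccont q z).
  { intros z Hz Hn. destruct (HFn z Hz Hn) as [d [Hd Hw]].
    apply (cder_ccont q q1 z d Hd); [|now apply Hqb].
    intros w Hlt. destruct (Hw w Hlt). now apply Hq. }
  set (good := fun z => F z <> 0 /\ sector (PI * alpha / 2) (q z)).
  assert (Hopen : forall z, (Cmod z < 1)%R -> good z ->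
    exists d, (0 < d)%R /\ forall w, (Cmod (w - z) < d)%R -> good w).
  { intros z Hz [Hn Hs]. destruct (HFn z Hz Hn) as [d1 [Hd1 Hw1]].
    destruct (sector_open _ _ Hbeta Hs) as [e [He Hse]].
    destruct (Hqc z Hz Hn e He) as [d2 [Hd2 Hw2]].
    exists (Rmin d1 d2). split; [now apply Rmin_pos|]. intros w Hw. split.
    - apply Hw1. eapply Rlt_le_trans; [exact Hw|apply Rmin_l].
    - apply Hse, Hw2. eapply Rlt_le_trans; [exact Hw|apply Rmin_r]. }
  assert (HF0 : F 0 = 1).
  { unfold F. rewrite powser_0 by exact HA0. unfold hyp_coef. simpl. field. }
  assert (Hq0 : q 0 = 1).
  { unfold q, quot. rewrite HF0. field. }
  apply NNPP. intros Hbad.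
  destruct (compact_max (fun z => (Cmod z <= Cmod z1)%R /\ ~ good z)
     (fun z => (- Cmod z)%R) (Cmod z1)) as (z0 & [Hz0 Hz0b] & Hmin).
  - now intros z [Hz _].
  - intros z Hz. destruct (Rle_dec (Cmod z) (Cmod z1)) as [Hle|Hgt].
    + assert (Hg : good z) by (apply NNPP; tauto).
      destruct (Hopen z ltac:(lra) Hg) as [d [Hd Hw]].
      exists d. split; [exact Hd|]. intros w Hlt [_ Hb]. apply Hb. now apply Hw.
    + exists (Cmod z - Cmod z1)%R. split; [lra|]. intros w Hlt [Hw _].
      pose proof (Cmod_triangle (z - w) w) as Ht.
      replace (z - w + w) with z in Ht by ring.
      replace (z - w) with (- (w - z)) in Ht by ring. rewrite Cmod_opp in Ht. lra.
  - exists z1. split; [apply Rle_refl|exact Hbad].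
  - intros z _ e He. exists e. split; [exact He|]. intros w _ Hlt.
    pose proof (Cmod_triangle (z - w) w) as Ht.
    replace (z - w + w) with z in Ht by ring.
    replace (z - w) with (- (w - z)) in Ht by ring. rewrite Cmod_opp in Ht. lra.
  - assert (Hin : forall w, (Cmod w < Cmod z0)%R -> good w).
    { intros w Hw. apply NNPP. intros Hb.
      assert (- Cmod w <= - Cmod z0)%R; [|lra]. apply Hmin. split; [lra|exact Hb]. }
    assert (Hz0n : z0 <> 0).
    { intros E. apply Hz0b. rewrite E. split.
      - rewrite HF0. apply C1_nz.
      - rewrite Hq0. unfold sector. simpl. rewrite Rabs_R0. lra. }
    assert (Hz01 : (Cmod z0 < 1)%R) by lra.
    assert (HFz0 : F z0 <> 0).
    { apply (quot_Re_pos_neq_0 F F1 z0 Hz0n).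
      - intros w Hw. apply cdiff_cder, HF. lra.
      - intros w Hw. destruct (Hin w Hw) as [Hn Hs]. split; [exact Hn|].
        now apply (sector_Re_pos _ _ Hbeta). }
    assert (Hsv : sector_valued alpha (Cmod z0) q q1).
    { split.
      - intros w Hw. apply Hq; [lra|now apply Hin].
      - intros w Hw. apply (ex_cder_quot_der F F1 F2 F3);
          [apply cdiff_cder; auto with real..|now apply Hin].
        + apply HF. lra.
        + apply HF1. lra.
        + apply HF2. lra.
      - intros w Hw. apply Hqb; [lra|now apply Hin].
      - intros w Hw. now apply Hin.
      - exact Hq0. }
    pose proof (Hq z0 Hz01 HFz0) as Hq1z0.
    pose proof (boundary_neq_0 alpha q q1 z0 _ Ha Hz0n Hsv Hq1z0) as Hqn.
    destruct (sector_limit_side _ (q z0) Hbeta Hqn) as (x & eps & Hx & He & Eq).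
    { intros Hs. apply Hz0b. now split. }
    { intros d Hd. destruct (Hqc z0 Hz01 HFz0 d Hd) as [e [He Hw]].
      pose proof Hz0n as Hzp. apply Cmod_gt_0 in Hzp.
      set (t := Rmin (/ 2) (e / (2 * Cmod z0))).
      assert (Ht : (0 < t)%R) by (apply Rmin_pos; [lra|apply Rdiv_lt_0_compat; lra]).
      assert (Ht1 : (t <= / 2)%R) by apply Rmin_l.
      assert (Ht2 : (t * Cmod z0 < e)%R).
      { apply Rle_lt_trans with (e / (2 * Cmod z0) * Cmod z0)%R.
        - apply Rmult_le_compat_r; [lra|apply Rmin_r].
        - replace (e / (2 * Cmod z0) * Cmod z0)%R with (e / 2)%R by (field; lra). lra. }
      exists (q (z0 + t * - z0)). split.
      - apply Hw. replace (z0 + t * - z0 - z0) with (t * - z0) by ring.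
        rewrite Cmod_mult, Cmod_R, Cmod_opp, Rabs_pos_eq; lra.
      - apply Hin. rewrite Cmod_radial by lra. nra. }
    destruct (boundary_log_derivative alpha x eps q q1 z0 _ Ha Hz0n Hsv Hq1z0 Hx He Eq)
      as [HRe HIm].
    set (s := exp (/ alpha * ln x)) in *.
    set (kappa := z0 * q1 z0 / q z0) in *.
    assert (Hs : (0 < s)%R) by apply exp_pos.
    assert (Hsx : Rpower s alpha = x).
    { unfold Rpower, s. rewrite ln_exp.
      replace (alpha * (/ alpha * ln x))%R with (ln x) by (field; lra). now apply exp_ln. }
    pose proof (HG s eps Hs He) as HGs. rewrite Hsx in HGs.
    set (Q := Re ((a * b - p) * expi (eps * (PI * (1 - alpha) / 2)))) in *.
    assert (HQ : (0 < Q)%R).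
    { unfold Q. rewrite Re_mul_expi_side by exact He. unfold sector in HP.
      assert (eps * Im (a * b - p)%C <= Rabs (Im (a * b - p)%C))%R; [|nra].
      destruct He as [-> | ->].
      - rewrite Rmult_1_l. apply Rle_abs.
      - rewrite <- Rabs_Ropp. replace (-1 * Im (a * b - p))%R with (- Im (a * b - p)%C)%R by ring.
        apply Rle_abs. }
    apply (side_contradiction alpha x (eps * Im kappa) eps p a b c z0
             (z0 * q1 z0) (q z0) Ha Hx He Hz01 Hp HP Eq).
    + assert (Ek : z0 * q1 z0 = kappa * q z0) by (unfold kappa; field; exact Hqn).
      rewrite Ek. f_equal. apply injective_projections; simpl.
      * exact HRe.
      * change (snd kappa) with (Im kappa).
        destruct He as [-> | ->]; ring.
    + eapply Rle_trans; [exact HGs|]. fold Q.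
      assert (0 < x * Q)%R by now apply Rmult_lt_0_compat. nra.
    + exact (quot_equation a b c z0 p Hc Hz01 Hp HFz0).
Qed.

Local Close Scope C_scope.

Theorem theorem4 (alpha : R) (a b c : C) (p : R)
  (halpha : (0 < alpha < 1)%R)
  (hab : (a * b <> 0)%C)
  (hc : forall n : nat, c <> (- INR n)%C)
  (h1 : RtoC p = (a + b + 1 - c)%C)
  (h2 : abs_arg_lt (a * b - p)%C (PI * alpha / 2))
  (h3 : forall s eps : R, (0 < s)%R -> eps = 1%R \/ eps = (-1)%R ->
     (G alpha a b c p eps (Rpower s alpha)
      <= alpha * (s + / s) * Rpower s alpha
         * Re ((a * b - p)%C * expi (eps * (PI * (1 - alpha) / 2)))%C)%R) :
  strongly_starlike alpha (fun z : C => (z * hyp2F1 a b c z)%C).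
Proof.
  pose proof (half_angle alpha halpha) as Hbeta.
  pose proof (tempered_hyp_coef a b c hc) as HA.
  apply (abs_arg_lt_sector _ _ Hbeta) in h2.
  pose proof (quot_in_sector alpha a b c p halpha hc h1 h2 h3) as Hgood.
  cbv zeta in Hgood.
  assert (HD : forall z : C, (Cmod z < 1)%R ->
    is_derive (fun z : C => (z * hyp2F1 a b c z)%C) z
      (powser (hyp_coef a b c) z + z * powser (dcoef (hyp_coef a b c)) z)%C).
  { intros z Hz. apply cdiff_is_derive.
    apply (cdiff_mul_id (powser (hyp_coef a b c))). now apply cdiff_powser. }
  split; [|split; [|split]].
  - intros z Hz. eexists. now apply HD.
  - ring.
  - rewrite (is_C_derive_unique _ _ _ (HD 0%C ltac:(rewrite Cmod_0; lra))).
    rewrite powser_0 by exact HA. unfold hyp_coef. simpl. field.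
  - intros z Hz. destruct (Hgood z Hz) as [Hn Hs]. split.
    + intros Hz0. now apply Cmult_neq_0.
    + apply (abs_arg_lt_sector _ _ Hbeta). unfold starlike_quotient.
      destruct (Ceq_dec z 0) as [E|Hz0].
      * unfold sector. simpl. rewrite Rabs_R0.
        destruct (cos_sin_pos _ Hbeta) as [Hcos Hsin]. lra.
      * rewrite (is_C_derive_unique _ _ _ (HD z Hz)), hyp2F1_powser.
        match goal with |- sector _ ?w => replace w with
          (quot (powser (hyp_coef a b c)) (powser (dcoef (hyp_coef a b c))) z) end;
          [exact Hs|].
        unfold quot. field. now split.
Qed.
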